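(* Let $N\ge1$, let $\mathfrak{M}^N$ be a probability measure on $\mathbb{W}^N$, and let $\mathsf{M}_N$ be the (Gibbs) probability measure on $\mathsf{GT}_N$ with density $$\mathsf{M}_N(x^1,\dots,x^N)=\mathfrak{M}^N(x^N)\,\mathfrak{L}^N_{N-1}(x^N,x^{N-1})\cdots\mathfrak{L}^2_1(x^2,x^1).$$ Consider the inhomogeneous space push-block dynamics $(\mathsf{X}_N(t;\mathsf{M}_N);t\ge0)=((\mathsf{X}^1(t),\dots,\mathsf{X}^N(t));t\ge 0)$ on $\mathsf{GT}_N$ with initial distribution $\mathsf{M}_N$. Then for each $1\le k\le N$ the projection on the $k$-th level $(\mathsf{X}^k(t);t\ge0)$ is distributed as a Markov process evolving according to $(\mathfrak{P}_t^k;t\ge0)$. Moreover, for any fixed $T\ge 0$, the law of $(\mathsf{X}^1(T),\dots,\mathsf{X}^N(T))$ is the evolved Gibbs measure on $\mathsf{GT}_N$ with density $$(x^1,\dots,x^N)\mapsto\left[\mathfrak{M}^N\mathfrak{P}^N_T\right](x^N)\,\mathfrak{L}^N_{N-1}(x^N,x^{N-1})\cdots\mathfrak{L}^2_1(x^2,x^1).$$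
   Context: $\mathbb{Z}_+=\{0,1,2,\dots\}$ and $\lambda:\mathbb{Z}_+\to(0,\infty)$ satisfies $0<\inf\lambda\le\sup\lambda<\infty$. $e^{t\mathsf{L}}(x,y)$ is the probability that the pure-birth chain on $\mathbb{Z}_+$, jumping from $x$ to $x+1$ at rate $\lambda(x)$ (generator $\mathsf{L}f(x)=\lambda(x)(f(x+1)-f(x))$), goes from $x$ to $y$ in time $t$. $\mathbb{W}^N=\{x\in\mathbb{Z}_+^N:x_1<\dots<x_N\}$; for $y\in\mathbb{W}^N,x\in\mathbb{W}^{N+1}$, $y\prec x$ means $x_1\le y_1<x_2\le\dots<x_N\le y_N<x_{N+1}$. $\mathsf{GT}_N$ is the set of $(x^1,\dots,x^N)$ with $x^i\in\mathbb{W}^i$ and $x^i\prec x^{i+1}$ for $1\le i\le N-1$. Functions $\mathfrak{h}_k$ on $\mathbb{W}^k$: $\mathfrak{h}_1\equiv1$, $\mathfrak{h}_{k+1}(x)=\sum_{y\in\mathbb{W}^k,\,y\prec x}\prod_{i=1}^k\lambda(y_i)^{-1}\,\mathfrak{h}_k(y)$; they are strictly positive. Define the Markov kernels and Markov semigroups $$\mathfrak{L}_{k}^{k+1}(x,y)=\frac{\mathfrak{h}_k(y)}{\mathfrak{h}_{k+1}(x)}\prod_{i=1}^k\frac{1}{\lambda(y_i)}\mathbf{1}(y\prec x),\ x\in\mathbb{W}^{k+1},y\in\mathbb{W}^k;\qquad \mathfrak{P}_t^k(x,y)=\frac{\mathfrak{h}_k(y)}{\mathfrak{h}_k(x)}\det\big(e^{t\mathsf{L}}(x_i,y_j)\big)_{i,j=1}^k,\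 x,y\in\mathbb{W}^k.$$ $[\mathfrak{M}^N\mathfrak{P}_T^N](x)=\sum_{z\in\mathbb{W}^N}\mathfrak{M}^N(z)\mathfrak{P}_T^N(z,x)$. Inhomogeneous space push-block dynamics: a continuous-time Markov jump process $(\mathsf{X}^1(t),\dots,\mathsf{X}^N(t))$ on $\mathsf{GT}_N$ with $\mathsf{X}^n(t)=(\mathsf{X}^n_1(t),\dots,\mathsf{X}^n_n(t))\in\mathbb{W}^n$. Each particle has an independent exponential clock, of rate $\lambda(\star)$ when its current position is $\star$, for jumping to the right by one. When the clock of $\mathsf{X}^n_k$ rings: (blocking) if $k\le n-1$ and $\mathsf{X}^{n-1}_k=\mathsf{X}^n_k$ the jump is blocked; (pushing) otherwise $\mathsf{X}^n_k$ moves to the right by one, and if this breaks the interlacing with $\mathsf{X}^{n+1}_{k+1}$ (the new value of $\mathsf{X}^n_k$ equals $\mathsf{X}^{n+1}_{k+1}$), then $\mathsf{X}^{n+1}_{k+1}$ also moves instantaneously to the right by one, and this pushing is propagated instantaneously to higher levels if needed. *)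

(* Defs.v *)
From HB Require Import structures.
From mathcomp Require Import all_boot all_order all_algebra zify.
From mathcomp Require Import all_classical all_reals all_analysis.

Set Implicit Arguments.
Unset Strict Implicit.
Unset Printing Implicit Defensive.

Import Order.TTheory GRing.Theory Num.Theory.
Import numFieldNormedType.Exports.

Local Open Scope classical_set_scope.
Local Open Scope ring_scope.

(* All indices start at 0: the paper's coordinate x_i is [nth 0%N x i.-1], and
   level n of a Gelfand-Tsetlin pattern is its component n.-1. *)

(** * Continuous-time Markov chains on a countable state space *)

Section MarkovChains.
Variables (R : realType) (S : countType).

(* The sums are over nonnegative families, for which [\esum] is the usual
   (unconditional) sum in [0, +oo]. *)
Record transition_function (p : R -> S -> S -> R) : Prop := {
  transition_ge0 : forall t x y, 0 <= t -> 0 <= p t x y ;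
  transition_sum1 : forall t x, 0 <= t ->
    (\esum_(y in [set: S]) (p t x y)%:E = 1)%E ;
  transition_id : forall x y, p 0 x y = (x == y)%:R ;
  transition_comp : forall s t x y, 0 <= s -> 0 <= t ->
    ((p (s + t) x y)%:E = \esum_(z in [set: S]) (p s x z * p t z y)%:E)%E }.

(* [p] is the transition function of a chain that jumps from [x] to [y <> x] at
   rate [q x y]; the diagonal of [q] is irrelevant. If the total rates out of
   the states are bounded there is exactly one such [p], namely exp(tQ), with Q
   the conservative Q-matrix given by [q]. *)
Record jump_transition_function (q : S -> S -> R) (p : R -> S -> S -> R) :
    Prop := {
  jump_transition : transition_function p ;
  jump_rate : forall x y, x != y -> p h x y / h @[h --> 0^'+] --> q x y ;
  jump_total_rate : forall x,
    ((1 - p h x x) / h)%:E @[h --> 0^'+] -->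
      (\esum_(y in [set y | y != x]) (q x y)%:E)%E }.

Variables (d : measure_display) (Omega : measurableType d).
Variable P : probability Omega R.

(* [X] evolves as a Markov process with transition probabilities [p]: its
   finite-dimensional distributions are those given by [p] and the law of
   [X 0]. *)
Definition markov_process (X : R -> Omega -> S) (p : R -> S -> S -> R) : Prop :=
  (forall t x, 0 <= t -> measurable [set w | X t w = x]) /\
  (forall (n : nat) (t : nat -> R) (x : nat -> S),
    t 0%N = 0 -> (forall i, (i < n)%N -> t i <= t i.+1) ->
    (P [set w | forall i, (i <= n)%N -> X (t i) w = x i] =
     P [set w | X 0%R w = x 0%N] *
       (\prod_(i < n) p (t i.+1 - t i) (x i) (x i.+1))%:E)%E).

(* Right continuity and existence of left limits for the discrete topology of
   [S]: the path is piecewise constant, with finitely many jumps on bounded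
   time intervals. *)
Definition jump_path (f : R -> S) : Prop :=
  (forall t, 0 <= t -> \forall s \near t^'+, f s = f t) /\
  (forall t, 0 < t -> exists x, \forall s \near t^'-, f s = x).

Definition markov_jump_process (X : R -> Omega -> S) (q : S -> S -> R) : Prop :=
  (forall w, jump_path (X ^~ w)) /\
  exists2 p, jump_transition_function q p & markov_process X p.

End MarkovChains.

(* The pure-birth chain jumps from [x] to [x.+1] at rate [lambda x]. *)
Definition pure_birth_rate (R : realType) (lambda : nat -> R) (x y : nat) : R :=
  lambda x * (y == x.+1)%:R.

(** * Interlacing configurations *)

Record W (n : nat) := MkW { wval :> n.-tuple nat ; _ : sorted ltn wval }.

HB.instance Definition _ n := [isSub for @wval n].
HB.instance Definition _ n := [Countable of W n by <:].

(* [interlaces y x] is y \prec x: x_i <= y_i < x_(i+1) for each index i of y. *)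
Definition interlaces (y x : seq nat) : bool :=
  all (fun i => nth 0 x i <= nth 0 y i < nth 0 x i.+1)%N (iota 0 (size y)).

Record GT (N : nat) := MkGT {
  levels : {dffun forall n : 'I_N, W n.+1} ;
  _ : [forall n : 'I_N, forall m : 'I_N,
         (m == n.+1 :> nat) ==> interlaces (levels n) (levels m)] }.

HB.instance Definition _ N := [isSub for @levels N].
HB.instance Definition _ N := [Countable of GT N by <:].

Definition level N (x : GT N) (n : 'I_N) : W n.+1 := levels x n.

(** * The kernels *)

Section Kernels.
Variables (R : realType) (lambda : nat -> R).

(* The sum has finite support. *)
Fixpoint hfun (k : nat) : W k -> R :=
  match k with
  | 0 => fun=> 1
  | k'.+1 => fun x =>
      if k' == 0%N then 1 else
      \sum_(y \in [set y : W k' | interlaces y x])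
        ((\prod_(i < k') (lambda (nth 0%N y i))^-1) * hfun y)
  end.

Definition Lkernel (k : nat) (x : W k.+1) (y : W k) : R :=
  hfun y / hfun x * (\prod_(i < k) (lambda (nth 0%N y i))^-1)
    * (interlaces y x)%:R.

(* [etL t x y] stands for e^{tL}(x, y). *)
Definition Pkernel (etL : R -> nat -> nat -> R) (k : nat) (t : R) (x y : W k) :
    R :=
  hfun y / hfun x * \det (\matrix_(i < k, j < k) etL t (nth 0%N x i) (nth 0%N y j)).

(* The Gibbs density on patterns with N + 1 levels and top-level density [m]. *)
Definition gibbs (N : nat) (m : W N.+1 -> \bar R) (x : GT N.+1) : \bar R :=
  (m (level x ord_max) *
   (\prod_(i < N) @Lkernel i.+1 (level x (lift ord0 i))
                      (level x (widen_ord (leqnSn N) i)))%:E)%E.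

Definition evolve (S : countType) (m : S -> R) (p : S -> S -> R) (x : S) :
    \bar R :=
  (\esum_(z in [set: S]) (m z * p z x)%:E)%E.

End Kernels.

(** * Push-block dynamics *)

(* Arrays [c], where [c n k] is the position of particle k of level n, both
   counted from 0 (so that k <= n). *)

Definition coords N (x : GT N) (n k : nat) : nat :=
  if insub n is Some n' then nth 0 (level x n') k else 0.

Definition blocked (c : nat -> nat -> nat) (n k : nat) : bool :=
  (k < n)%N && (c n.-1 k == c n k).

Definition move_right (c : nat -> nat -> nat) (n k : nat) : nat -> nat -> nat :=
  fun m j => (c m j + ((m == n) && (j == k)))%N.

(* Particle (n, k) moves, and pushes particle (n + 1, k + 1) if it lands on it,
   and so on; [above] is the number of levels above level n. *)
Fixpoint push (above : nat) (c : nat -> nat -> nat) (n k : nat) :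
    nat -> nat -> nat :=
  let c' := move_right c n k in
  if above is above'.+1 then
    if c' n k == c' n.+1 k.+1 then push above' c' n.+1 k.+1 else c'
  else c'.

Definition ring_clock (N : nat) (c : nat -> nat -> nat) (n k : nat) :
    nat -> nat -> nat :=
  if blocked c n k then c else push (N - n.+1) c n k.

Definition ring_leads_to N (x : GT N) (n k : nat) (y : GT N) : bool :=
  [forall m : 'I_N, forall j : 'I_m.+1,
     coords y m j == ring_clock N (coords x) n k m j].

(* The rate of the jump from [x] to [y] is the sum of the rates of the clocks
   whose ringing turns [x] into [y]. A blocked ring only contributes to the
   diagonal. By [ring_leads_toP] below, every ring leads to exactly one pattern,
   so that no clock is lost. *)
Definition push_block_rate (R : realType) (lambda : nat -> R) (N : nat)
    (x y : GT N) : R :=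
  \sum_(n < N) \sum_(k < n.+1)
    lambda (coords x n k) * (ring_leads_to x n k y)%:R.

Section RingLeadsTo.
Local Open Scope nat_scope.

Let GT_array N (c : nat -> nat -> nat) := forall n k, n.+1 < N -> k <= n ->
  c n.+1 k <= c n k < c n.+1 k.+1.

Let coordsE N (x : GT N) (n : 'I_N) k : coords x n k = nth 0 (level x n) k.
Proof. by rewrite /coords valK. Qed.

Let coordsP N (x : GT N) : GT_array N (coords x).
Proof.
move=> n k nN kn; case: x => x xP.
have nN' : n < N by lia.
have /forallP/(_ (Ordinal nN'))/forallP/(_ (Ordinal nN)) /= := xP.
rewrite eqxx /= => /allP/(_ k).
rewrite size_tuple mem_iota /= add0n ltnS kn => /(_ isT).
by rewrite !(coordsE (MkGT xP) (Ordinal nN)) (coordsE (MkGT xP) (Ordinal nN')).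
Qed.

Let arrayP N c : GT_array N c ->
  exists y : GT N, forall (m : 'I_N) (j : 'I_m.+1), coords y m j = c m j.
Proof.
move=> cP.
have tE (m : 'I_N) i : i < m.+1 ->
    nth 0 [tuple c m (val j) | j < m.+1] i = c m i.
  by move=> im; rewrite -(tnth_nth 0 _ (Ordinal im)) tnth_mktuple.
have srt (m : 'I_N) : sorted ltn [tuple c m (val j) | j < m.+1].
  apply/(sortedP 0) => i; rewrite size_tuple ltnS => im.
  rewrite !tE; [|lia..].
  case: m im => -[//|m] mN /= im.
  by have := cP m i mN; lia.
pose l : {dffun forall n : 'I_N, W n.+1} := [ffun m : 'I_N => MkW (srt m)].
have lE (m : 'I_N) j : j < m.+1 -> nth 0 (l m) j = c m j.
  by move=> jm; rewrite ffunE tE.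
have lP : [forall n : 'I_N, forall m : 'I_N,
         (m == n.+1 :> nat) ==> interlaces (l n) (l m)].
  apply/forallP => n; apply/forallP => m; apply/implyP => /eqP mn.
  apply/allP => i; rewrite size_tuple mem_iota /= add0n => im.
  rewrite !lE ?mn//; last by lia.
  by apply: cP => //; rewrite -mn.
by exists (MkGT lP) => m j; rewrite coordsE /level /= lE.
Qed.

Let pushP N a c n k : n < N -> k <= n -> a = N - n.+1 ->
  (forall m j, m.+1 < N -> j <= m -> c m.+1 j <= c m j /\
     (c m j < c m.+1 j.+1 \/ m.+1 = n /\ j.+1 = k /\ c m j = c m.+1 j.+1)) ->
  (k < n -> c n k < c n.-1 k) ->
  GT_array N (push a c n k).
Proof.
elim: a c n k => [|a IH] c n k nN kn aE cP ck /=.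
  move=> m j mN jm; have [] := cP m j mN jm; rewrite /move_right.
  case: (m =P n) => [mn|mn]; first lia.
  case: (m.+1 =P n) => [m1|m1] /=; last lia.
  case: (j =P k) => [jk|jk]; case: (j.+1 =P k) => [j1|j1] /=; subst; try lia.
  by move: ck => /=; lia.
have n1N : n.+1 < N by lia.
have step m j : m.+1 < N -> j <= m ->
  move_right c n k m.+1 j <= move_right c n k m j /\
  (move_right c n k m j < move_right c n k m.+1 j.+1 \/
   m = n /\ j = k /\ move_right c n k m j = move_right c n k m.+1 j.+1).
  move=> mN jm; have [] := cP m j mN jm; rewrite /move_right.
  case: (m =P n) => [mn|mn].
    have -> : (m.+1 == n) = false by lia.
    by case: (j =P k) => /= ?; lia.
  case: (m.+1 =P n) => [m1|m1] /=; last lia.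
  case: (j =P k) => [jk|jk]; case: (j.+1 =P k) => [j1|j1] /=; subst; try lia.
  by move: ck => /=; lia.
case: eqP => e; last first.
  move=> m j mN jm; have [-> /=] := step m j mN jm.
  by case=> // -[-> [-> /e]].
apply: IH => //; first lia.
- move=> m j mN jm; have [? [?|[mn [jk ?]]]] := step m j mN jm; split=> //.
    by left.
  by right; lia.
- rewrite ltnS => kn1 /=; rewrite -e.
  have := ck kn1; case: n nN kn aE cP ck n1N step e kn1 => // n nN kn _ cP _ _ _ _ kn1.
  have [_] := cP n k nN ltac:(lia).
  rewrite /move_right /= !eqxx /=; have -> : (k.+1 == k) = false by lia.
  by lia.
Qed.

Lemma ring_leads_toP N (x : GT N) (n : 'I_N) (k : 'I_n.+1) :
  exists! y : GT N, ring_leads_to x n k y.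
Proof.
have [y yP] : exists y : GT N, forall (m : 'I_N) (j : 'I_m.+1),
    coords y m j = ring_clock N (coords x) n k m j.
  apply: arrayP; rewrite /ring_clock; case: ifP => [_|/negbT].
    exact: coordsP.
  rewrite /blocked negb_and => nb.
  apply: pushP => //.
  - by have := ltn_ord k; lia.
  - by move=> m j mN jm; have /andP[] := coordsP x mN jm; split=> //; left.
  - move=> kn; move: nb kn; case: n k => -[//|n] nN k /= nb kn.
    have /andP[] := @coordsP N x n k nN kn.
    by move: nb; rewrite kn /=; lia.
exists y; split => [|z /forallP zP].
  by apply/forallP => m; apply/forallP => j; rewrite yP.
apply/val_inj/ffunP => m; apply/val_inj/eq_from_tnth => j.
have /forallP/(_ j)/eqP := zP m; rewrite -yP !coordsE /level.
by rewrite !(tnth_nth 0).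
Qed.

End RingLeadsTo.

(* Main.v *)
(** Idea. For a pattern g on the levels 0, ..., k put w(g) = prod 1/lambda over
    the particles strictly below level k. A measure is Gibbs on these levels with
    top row y exactly when it gives mass r * w(g) to every g with top row y and
    0 to the others: the functions h_k telescope. The mass of g at time t, started
    from such a measure, and r * w(g) * det(e^{tL}(y_i, g^k_j)) solve the same
    forward equations. A configuration can only be entered from configurations
    with a smaller sum of coordinates, so this linear system is triangular and
    its solution is unique. Hence the Gibbs property is preserved, and
    conditioning on the level-k positions at successive times gives the Markov
    property and the formula for the law at a fixed time. *)

(* About [p] only Chapman-Kolmogorov and the jump rates at time 0, pointwise in the starting state,
   are known. A forward equation at time t is therefore a derivative at time 0 for the chain
   restarted from the evolved measure, taken under a sum over infinitely many states. The bound that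
   permits this exchange is 1 - p_h(x, x) <= C h, with C a bound on the total rates. The equations
   close on events that fix the levels 0, ..., k because pushes only travel upwards. They coincide
   with those of w(g) times the determinant for two reasons. Undoing a move changes w by the factor
   that trades the rate of the clock that rang for a rate at the last particle moved; moves that end
   below level k thus give multiples of the same determinant, which cancel the part of the outflow
   rate that the top row does not account for. Moves that end at level k give the equation of
   independent birth chains, and the terms by which the two could differ at the boundary are
   determinants with two equal columns. *)
Require Import Defs.
From mathcomp Require Import all_boot all_order all_algebra perm zify ring lra.
From mathcomp Require Import all_classical all_reals all_analysis.

Set Implicit Arguments.
Unset Strict Implicit.
Unset Printing Implicit Defensive.

Import Order.TTheory GRing.Theory Num.Theory.
Import numFieldNormedType.Exports.

Local Open Scope classical_set_scope.
Local Open Scope ring_scope.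

(** * Right derivatives *)

Section RightDerivative.
Variable R : realType.
Implicit Types f g : R -> R.

(* Transition functions make sense for nonnegative times only; a right derivative
   together with left continuity is enough for uniqueness in linear equations. *)
Record right_derivative f f' : Prop := {
  rder_right : forall t, 0 <= t ->
    (f (t + h) - f t) / h @[h --> 0^'+] --> f' t ;
  rder_left : forall t, 0 < t -> f s @[s --> t^'-] --> f t }.

Lemma cvg_id_right0 : h @[h --> 0^'+] --> (0 : R).
Proof. exact: cvg_at_right_filter (@cvg_id _ _). Qed.

Lemma rder_rcont f f' t : right_derivative f f' -> 0 <= t ->
  f (t + h) @[h --> 0^'+] --> f t.
Proof.
move=> [/(_ t) + _] t0 => /(_ t0) fd.
have : f t + (f (t + h) - f t) / h * h @[h --> 0^'+] --> f t + f' t * 0.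
  apply: cvgD; first exact: cvg_cst.
  by apply: cvgM; [exact: fd|exact: cvg_id_right0].
rewrite mulr0 addr0; apply: cvg_trans; apply: near_eq_cvg.
near=> h; have h0 : 0 < h by near: h; exact: nbhs_right_gt.
by rewrite divfK ?gt_eqF// subrKC.
Unshelve. all: by end_near. Qed.

Lemma rder_cst (c : R) : right_derivative (fun=> c) (fun=> 0).
Proof.
split=> t t0; last exact: cvg_cst.
by under eq_fun do rewrite subrr mul0r; exact: cvg_cst.
Qed.

Lemma rderD f g f' g' : right_derivative f f' -> right_derivative g g' ->
  right_derivative (fun t => f t + g t) (fun t => f' t + g' t).
Proof.
move=> [fr fl] [gr gl]; split=> t t0; last by apply: cvgD; [exact: fl|exact: gl].
rewrite (_ : (fun h => _) = fun h =>
  (f (t + h) - f t) / h + (g (t + h) - g t) / h); last first.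
  by apply/funext => h; rewrite -mulrDl addrACA opprD.
by apply: cvgD; [exact: fr|exact: gr].
Qed.

Lemma rderM f g f' g' : right_derivative f f' -> right_derivative g g' ->
  right_derivative (fun t => f t * g t) (fun t => f' t * g t + f t * g' t).
Proof.
move=> fd gd; have [fr fl] := fd; have [gr gl] := gd.
split=> t t0; last by apply: cvgM; [exact: fl|exact: gl].
rewrite (_ : (fun h => _) = fun h =>
  (f (t + h) - f t) / h * g (t + h) + f t * ((g (t + h) - g t) / h)); last first.
  by apply/funext => h; ring.
apply: cvgD; apply: cvgM; [exact: fr|exact: rder_rcont gd _|exact: cvg_cst|exact: gr].
Qed.

Lemma rder_ext f f1 f' f1' : right_derivative f f' ->
  (forall t, 0 <= t -> f t = f1 t) -> (forall t, 0 <= t -> f' t = f1' t) ->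
  right_derivative f1 f1'.
Proof.
move=> [fr fl] ff1 ff1'; split=> t t0.
  rewrite -ff1'//; apply: cvg_trans (fr t t0); apply: near_eq_cvg.
  near=> h; have h0 : 0 < h by near: h; exact: nbhs_right_gt.
  by rewrite !ff1// addr_ge0// ltW.
rewrite -ff1 ?ltW//; apply: cvg_trans (fl t t0); apply: near_eq_cvg.
near=> h; rewrite ff1// ltW//; near: h; exact: nbhs_left_gt.
Unshelve. all: by end_near. Qed.

Lemma rderZ c f f' : right_derivative f f' ->
  right_derivative (fun t => c * f t) (fun t => c * f' t).
Proof.
move=> fd; apply: rder_ext (rderM (rder_cst c) fd) _ _ => // t _.
by rewrite mul0r add0r.
Qed.

Lemma rder_sum (I : Type) (s : seq I) (P : pred I) (F F' : I -> R -> R) :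
  (forall i, P i -> right_derivative (F i) (F' i)) ->
  right_derivative (fun t => \sum_(i <- s | P i) F i t)
    (fun t => \sum_(i <- s | P i) F' i t).
Proof.
move=> FF'; elim: s => [|i s IH].
  by apply: rder_ext (rder_cst 0) _ _ => t _; rewrite big_nil.
have [Pi|Pi] := boolP (P i).
  by apply: rder_ext (rderD (FF' i Pi) IH) _ _ => t _; rewrite big_cons Pi.
by apply: rder_ext IH _ _ => t _; rewrite big_cons (negbTE Pi).
Qed.

Lemma rder_prod n (F F' : 'I_n -> R -> R) :
  (forall i, right_derivative (F i) (F' i)) ->
  right_derivative (fun t => \prod_(i < n) F i t)
    (fun t => \sum_(i < n) \prod_(j < n) (if j == i then F' else F) j t).
Proof.
elim: n F F' => [|n IH] F F' FF'.
  by apply: rder_ext (rder_cst 1) _ _ => t _; rewrite big_ord0.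
have := rderM (FF' ord0) (IH (F \o lift ord0) (F' \o lift ord0) (fun=> FF' _)).
move=> /rder_ext; apply=> t t0; first by rewrite big_ord_recl.
rewrite [RHS]big_ord_recl; congr (_ + _).
  by rewrite [RHS]big_ord_recl eqxx.
rewrite mulr_sumr; apply: eq_bigr => i _.
rewrite [RHS]big_ord_recl (negbTE (neq_lift _ _)); congr (_ * _).
by apply: eq_bigr => j _; rewrite (inj_eq lift_inj) /=; case: ifP.
Qed.

(** With one-sided derivatives the mean value theorem is replaced by a continuation argument: f
    stays below a line of small positive slope c up to a largest time [sup E]. Left continuity
    carries the bound to [sup E] itself, and a right derivative below c carries it further unless
    [sup E = T]. *)
Lemma rder_le f f' T : right_derivative f f' -> (forall t, 0 <= t -> f' t <= 0) ->
  0 <= T -> f T <= f 0.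
Proof.
move=> [fr fl] f'0 T0; apply/ler_addgt0Pl => e e0.
have [T_eq0|T_gt0] := eqVneq T 0; first by rewrite T_eq0 lerDr ltW.
have {}T_gt0 : 0 < T by rewrite lt_def T_gt0.
(* The line of slope c rises by exactly e on [0, T]. *)
pose c := e / T; have c0 : 0 < c by rewrite divr_gt0.
pose E := [set t | 0 <= t <= T /\ forall s, 0 <= s <= t -> f s <= f 0 + c * s].
have E0 : E 0.
  split; first by rewrite lexx.
  by move=> s; rewrite -eq_le => /eqP<-; rewrite mulr0 addr0.
have Es : has_sup E.
  by split; [exists 0|exists T => t [/andP[]]].
have s0 : 0 <= sup E by exact: sup_upper_bound.
have sT : sup E <= T by apply: ge_sup; [exists 0|move=> t [/andP[]]].
have lts s : 0 <= s -> s < sup E -> f s <= f 0 + c * s.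
  move=> s_ge0 ss; have Ess : 0 < sup E - s by rewrite subr_gt0.
  have [u [_ uE]] := sup_adherent Ess Es.
  by rewrite subKr => su; apply: uE; rewrite s_ge0 ltW.
have les s : 0 <= s <= sup E -> f s <= f 0 + c * s.
  move=> /andP[s_ge0]; rewrite le_eqVlt => /orP[/eqP sE|]; last exact: lts.
  move: s_ge0; rewrite le_eqVlt => /orP[/eqP<-|s_gt0]; first by rewrite mulr0 addr0.
  rewrite -lerBlDr; apply: (@cvgr_to_le _ (s^'-) _ _ (fun u => f u - c * u)).
    apply: cvgB; first exact: fl.
    by apply: cvgMl_tmp; exact: cvg_at_left_filter (@cvg_id _ _).
  near=> u; rewrite lerBlDr; apply: lts.
    by apply: ltW; near: u; exact: nbhs_left_gt.
  by rewrite -sE; near: u; exact: nbhs_left_lt.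
suff sTE : sup E = T.
  by have := les T; rewrite sTE lexx T0 /c divfK ?gt_eqF// [e + _]addrC; exact.
apply/eqP; rewrite eq_le sT /= leNgt; apply/negP => sltT.
have := fr _ s0 => /cvgr_lt/(_ c (le_lt_trans (f'0 _ s0) c0)).
rewrite near_withinE => /nbhs_ballP[r /= r0 rP].
(* Half of r stays inside the ball where the difference quotient is below c; the other bound keeps
   [sup E + u] at most T. *)
pose u := Num.min (r / 2) (T - sup E).
have u0 : 0 < u by rewrite lt_min divr_gt0//= subr_gt0.
suff : E (sup E + u) by move=> /(sup_upper_bound Es); rewrite gerDl leNgt u0.
have uT : u <= T - sup E by rewrite ge_min lexx orbT.
split; first by rewrite addr_ge0 ?(ltW u0)//= addrC -lerBrDr.
move=> s /andP[s_ge0 ssu]; have [|ss] := leP s (sup E); first by move=> ?;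
  apply: les; rewrite s_ge0.
have := rP (s - sup E); rewrite subrKC => /(_ _ _)/ltW; rewrite ler_pdivrMr ?subr_gt0//.
move=> /(_ _ _) fs; have {}fs : f s - f (sup E) <= c * (s - sup E).
  apply: fs => //; rewrite /ball /= sub0r normrN gtr0_norm ?subr_gt0//.
  rewrite ltrBlDl (le_lt_trans ssu)// ltrD2l gt_min; apply/orP; left.
  by rewrite ltr_pdivrMr// ltr_pMr// ltr1n.
have := les (sup E); rewrite s0 lexx => /(_ isT); lra.
Unshelve. all: by end_near. Qed.

(** The square of f has right derivative -2 c f^2 <= 0 and starts at 0, so it never becomes
    positive. *)
Lemma rder_linear_eq0 f c : 0 <= c -> right_derivative f (fun t => - (c * f t)) ->
  f 0 = 0 -> forall t, 0 <= t -> f t = 0.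
Proof.
move=> c0 fd f0 t t0; apply/eqP; rewrite -sqrf_eq0; apply/eqP/le_anti.
rewrite sqr_ge0 andbT; have := rder_le (rderM fd fd) _ t0.
rewrite f0 mul0r -expr2; apply=> s s0.
have -> : - (c * f s) * f s + f s * - (c * f s) = - (2 * c * f s ^+ 2) by ring.
by rewrite oppr_le0 mulr_ge0 ?sqr_ge0// mulr_ge0.
Qed.

End RightDerivative.

(** * Weighted sums over countable sets *)

Section WeightedSums.
Variables (R : realType).
Implicit Types S T : choiceType.

(** One inequality holds for every nonnegative factor; for c > 0 the other one is the same
    inequality with factor 1/c. *)
Lemma esumZl S (A : set S) (c : R) (a : S -> \bar R) : 0 <= c ->
  (forall i, 0 <= a i)%E ->
  (\esum_(i in A) (c%:E * a i) = c%:E * \esum_(i in A) a i)%E.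
Proof.
have le1 (b : S -> \bar R) (e : R) : 0 <= e -> (forall i, 0 <= b i)%E ->
    (\esum_(i in A) (e%:E * b i) <= e%:E * \esum_(i in A) b i)%E.
  move=> e0 b0; apply: ge_ereal_sup => _ [X [Xfin XA] <-].
  rewrite -ge0_mule_fsumr//; apply: lee_wpmul2l; first by rewrite lee_fin.
  by apply: esum_ge; exists X.
move=> c0 a0; apply/eqP; rewrite eq_le le1//=.
move: (c0); rewrite le0r => /predU1P[->|{}c0].
  by rewrite mul0e; apply: esum_ge0 => i _; rewrite mul0e.
rewrite -lee_pdivlMl// [leRHS](_ : _ = (c^-1)%:E * \esum_(i in A) (c%:E * a i))%E//.
apply: le_trans (le1 _ _ _ _); last 2 first.
- by rewrite invr_ge0 ltW.
- by move=> i; rewrite mule_ge0// lee_fin ltW.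
by apply: le_esum => i _; rewrite muleA -EFinM mulVf ?gt_eqF// mul1e.
Qed.

Lemma esum_exchange S T (A : set S) (B : set T) (a : S -> T -> \bar R) :
  (forall i j, 0 <= a i j)%E ->
  (\esum_(i in A) \esum_(j in B) a i j = \esum_(j in B) \esum_(i in A) a i j)%E.
Proof.
move=> a0; rewrite !esum_esum//.
rewrite (reindex_esum (B `*`` (fun=> A)) _ (fun x => (x.2, x.1)))//; split=> //=.
- by move=> [j i] /= [].
- by move=> [i1 i2] [j1 j2] /= _ _ [-> ->].
- by move=> [i j] [Ai Bj] /=; exists (j, i).
Qed.

Lemma esum_indic S (A : set S) (a : S -> \bar R) :
  (\esum_(i in A) a i = \esum_(i in [set: S]) (a i * ((i \in A)%:R)%:E))%E.
Proof.
rewrite esum_mkcond; apply: eq_esum => i _; case: ifP => _; first by rewrite mule1.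
by rewrite mule0.
Qed.

Definition summable_weight S (U : S -> R) : Prop :=
  (forall x, 0 <= U x) /\ (\esum_(x in [set: S]) (U x)%:E < +oo)%E.

(** Real-valued, so that it can be differentiated in time; for summable U and [bounded_nonneg] g the
    sum is finite and [fine] loses nothing. *)
Definition wsum S (U g : S -> R) : R :=
  fine (\esum_(x in [set: S]) (U x * g x)%:E)%E.

Definition bounded_nonneg S (g : S -> R) : Prop :=
  exists K, forall x, 0 <= g x <= K.

Definition wmass S (U : S -> R) (A : set S) : R := wsum U (fun x => (x \in A)%:R).

Lemma bounded_nonneg_indic S (A : set S) :
  bounded_nonneg (fun x => (x \in A)%:R : R).
Proof. by exists 1 => x; rewrite ler0n lern1 leq_b1. Qed.

Lemma bounded_nonnegD S (g1 g2 : S -> R) : bounded_nonneg g1 -> bounded_nonneg g2 ->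
  bounded_nonneg (fun x => g1 x + g2 x).
Proof.
move=> [K1 g1P] [K2 g2P]; exists (K1 + K2) => x.
by have /andP[? ?] := g1P x; have /andP[? ?] := g2P x; rewrite addr_ge0//= lerD.
Qed.

Lemma bounded_nonnegZ S (c : R) (g : S -> R) : 0 <= c -> bounded_nonneg g ->
  bounded_nonneg (fun x => c * g x).
Proof.
move=> c0 [K gP]; exists (c * K) => x; have /andP[? ?] := gP x.
by rewrite mulr_ge0//= ler_wpM2l.
Qed.

Lemma bounded_nonneg_cst S (c : R) : 0 <= c -> bounded_nonneg (fun=> c : R) (S := S).
Proof. by move=> c0; exists c => x; rewrite c0 lexx. Qed.

Section Wsum.
Variables (S : choiceType) (U : S -> R).
Hypothesis UP : summable_weight U.
Implicit Types (g : S -> R) (A : set S).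

Lemma wsumE g : bounded_nonneg g ->
  ((wsum U g)%:E = \esum_(x in [set: S]) (U x * g x)%:E)%E.
Proof.
case: UP => U0 Ufin [K gP]; rewrite /wsum fineK// ge0_fin_numE; last first.
  by apply: esum_ge0 => x _; rewrite lee_fin mulr_ge0//; have /andP[] := gP x.
apply: (@le_lt_trans _ _ (\esum_(x in [set: S]) (`|K|%:E * (U x)%:E))%E).
  apply: le_esum => x _; rewrite lee_fin mulrC ler_wpM2r//.
  by have /andP[_ /le_trans] := gP x; apply; exact: ler_norm.
rewrite esumZl//.
by apply: lte_mul_pinfty => //; rewrite lee_fin normr_ge0.
Qed.

Lemma wsum_ge0 g : (forall x, 0 <= g x) -> 0 <= wsum U g.
Proof.
case: UP => U0 _ g0.
by apply: fine_ge0; apply: esum_ge0 => x _; rewrite lee_fin mulr_ge0.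
Qed.

Lemma wsumD g1 g2 : bounded_nonneg g1 -> bounded_nonneg g2 ->
  wsum U (fun x => g1 x + g2 x) = wsum U g1 + wsum U g2.
Proof.
move=> g1P g2P; apply: EFin_inj; rewrite EFinD !wsumE//; last exact: bounded_nonnegD.
have [U0 _] := UP; have [[K1 {}g1P] [K2 {}g2P]] := (g1P, g2P).
rewrite -esumD; first by apply: eq_esum => x _; rewrite mulrDr.
  by move=> x _; rewrite lee_fin mulr_ge0//; have /andP[] := g1P x.
by move=> x _; rewrite lee_fin mulr_ge0//; have /andP[] := g2P x.
Qed.

Lemma wsumZ c g : 0 <= c -> bounded_nonneg g -> wsum U (fun x =>
  c * g x) = c * wsum U g.
Proof.
move=> c0 gP; apply: EFin_inj; rewrite EFinM !wsumE//; last exact: bounded_nonnegZ.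
have [U0 _] := UP; have [K {}gP] := gP; rewrite -esumZl//.
  by apply: eq_esum => x _; rewrite -EFinM mulrCA.
by move=> x; rewrite lee_fin mulr_ge0//; have /andP[] := gP x.
Qed.

Lemma wsum0 : wsum U (fun=> 0) = 0.
Proof. by rewrite /wsum esum1// => x _; rewrite mulr0. Qed.

Lemma wsum_sum (I : Type) (r : seq I) (g : I -> S -> R) :
  (forall i, bounded_nonneg (g i)) ->
  bounded_nonneg (fun x => \sum_(i <- r) g i x) /\
  wsum U (fun x => \sum_(i <- r) g i x) = \sum_(i <- r) wsum U (g i).
Proof.
move=> gP; elim: r => [|i r [IHb IH]].
  rewrite big_nil; under eq_fun do rewrite big_nil.
  by rewrite wsum0; split => //; exact: bounded_nonneg_cst.
rewrite big_cons -IH; under eq_fun do rewrite big_cons.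
by split; [exact: bounded_nonnegD|exact: wsumD].
Qed.

Lemma le_wsum g1 g2 : (forall x, 0 <= g1 x) -> bounded_nonneg g2 ->
  (forall x, g1 x <= g2 x) -> wsum U g1 <= wsum U g2.
Proof.
move=> g10 g2P g12; have [K g2K] := g2P.
have g1P : bounded_nonneg g1.
  by exists K => x; rewrite g10 (le_trans (g12 x))//; have /andP[] := g2K x.
rewrite -lee_fin !wsumE//; apply: le_esum => x _.
by rewrite lee_fin ler_wpM2l//; case: UP.
Qed.

Lemma wmassE A : ((wmass U A)%:E = \esum_(x in A) (U x)%:E)%E.
Proof.
rewrite wsumE; last exact: bounded_nonneg_indic.
by rewrite [RHS]esum_indic; apply: eq_esum.
Qed.

Lemma wmass_set1 x : wmass U [set x] = U x.
Proof. by apply: EFin_inj; rewrite wmassE esum_set1// lee_fin; case: UP. Qed.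

(** Dominated convergence along an arbitrary filter: a finite set X carries all of U but a mass
    [del], which costs at most [K * del] for each integrand, and on X the sum is finite. *)
Lemma wsum_dominated (T : Type) (F : set_system T) {FF : ProperFilter F}
    (f : T -> S -> R) (f0 : S -> R) (K : R) :
  (\forall h \near F, forall x, 0 <= f h x <= K) ->
  (forall x, f h x @[h --> F] --> f0 x) ->
  wsum U (f h) @[h --> F] --> wsum U f0.
Proof.
move=> fK ff0; have [U0 Ufin] := UP.
have f0K x : 0 <= f0 x <= K.
  apply/andP; split.
    by apply: (cvgr_to_ge (ff0 x)); apply: filterS fK => h /(_ x)/andP[].
  by apply: (cvgr_to_le (ff0 x)); apply: filterS fK => h /(_ x)/andP[].
(* That K is nonnegative is read off at a point of S, so the empty S is treated apart. *)
have [y|Sempty] := pselect (exists y : S, True); last first.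
  have wE g : wsum U g = 0.
    by rewrite /wsum esum1// => x; case: Sempty; exists x.
  by under eq_fun do rewrite wE; rewrite wE; exact: cvg_cst.
have K0 : 0 <= K.
  by have [x _] := y; have /andP[] := f0K x; exact: le_trans.
apply/cvgrPdist_le => e e0.
(* The two tails, of the sums for [f h] and for [f0], cost at most e/4 each and leave e/2 for the
   finite sum. Dividing by K + 1 covers K = 0. *)
pose del := e / 4 / (K + 1).
have del0 : 0 < del by rewrite !divr_gt0// ltr_wpDl.
have [X [Xfin XT] XU] : exists2 X, finite_set X /\ X `<=` [set: S] &
    (\esum_(x in [set: S]) (U x)%:E - del%:E < \sum_(x \in X) (U x)%:E)%E.
  have : (\esum_(x in [set: S]) (U x)%:E - del%:E < \esum_(x in [set: S]) (U x)%:E)%E.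
    rewrite gte_subl ?lte_fin// ge0_fin_numE// esum_ge0// => x _.
    by rewrite lee_fin.
  by move=> /ereal_sup_gt[_ [X XP <-] ?]; exists X.
have tail g : (forall x, 0 <= g x <= K) ->
    `|wsum U g - \sum_(x <- finmap.enum_fset (fset_set X)) U x * g x| <= K * del.
  move=> gK; have gP : bounded_nonneg g by exists K.
  have XE (a : S -> R) : (forall x, 0 <= a x) ->
      (\esum_(x in [set: S]) (a x)%:E =
        (\sum_(x <- finmap.enum_fset (fset_set X)) a x)%:E +
         \esum_(x in ~` X) (a x)%:E)%E.
    move=> a0; rewrite (esumID X); last by move=> x _; rewrite lee_fin.
    rewrite !setTI; congr (_ + _)%E.
    by rewrite esum_fset// ?fsbig_finite//= ?sumEFin// => x _; rewrite lee_fin.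
  have tU : (\esum_(x in ~` X) (U x)%:E <= del%:E)%E.
    move: XU; rewrite XE// fsbig_finite//= sumEFin.
    by rewrite EFinN lteBlDr// lteD2lE// => /ltW.
  have := wsumE gP; rewrite XE; last by move=> x; rewrite mulr_ge0//;
    have /andP[] := gK x.
  have [t tE] : exists t, t = (\esum_(x in ~` X) (U x * g x)%:E)%E by eexists.
  rewrite -tE => wE.
  have t0 : (0 <= t)%E by rewrite tE; apply: esum_ge0 => x _;
    rewrite lee_fin mulr_ge0//; have /andP[] := gK x.
  have tK : (t <= (K * del)%:E)%E.
    rewrite tE; apply: (@le_trans _ _ (K%:E * \esum_(x in ~` X) (U x)%:E)%E);
      last first.
      by rewrite EFinM lee_wpmul2l// lee_fin.
    rewrite -esumZl//.
    by apply: le_esum => x _; rewrite lee_fin mulrC ler_wpM2r//; have /andP[] := gK x.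
  move: t0 tK wE; clear tE; case: t => [t| |]//=; rewrite !lee_fin => t0 tK [->].
  by rewrite addrAC subrr add0r ger0_norm.
have cvX : \sum_(x <- finmap.enum_fset (fset_set X)) U x * f h x @[h --> F] -->
    \sum_(x <- finmap.enum_fset (fset_set X)) U x * f0 x.
  apply: cvg_big => [|x _]; first exact: add_continuous.
  by apply: cvgMl_tmp.
have e2 : 0 < e / 2 by rewrite divr_gt0.
move/cvgrPdist_le : cvX => /(_ _ e2); apply: filterS2 fK => h fK cvX.
have Kd : K * del <= e / 4.
  have -> : K * del = (e / 4) * (K / (K + 1)) by rewrite /del; field;
    rewrite gt_eqF ?ltr_wpDl.
  apply: ler_piMr; first by rewrite divr_ge0// ltW.
  by rewrite ler_pdivrMr ?ltr_wpDl// mul1r lerDl.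
have := tail _ f0K; have := tail _ fK.
move: cvX; rewrite !ler_norml => /andP[? ?] /andP[? ?] /andP[? ?].
by apply/andP; split; lra.
Qed.
End Wsum.
End WeightedSums.

(** * Chains with bounded jump rates *)

Lemma mem_set1E (T : eqType) (x y : T) : (x \in [set y]) = (x == y).
Proof. by apply/idP/eqP => [/set_mem//|->]; exact/mem_set. Qed.

Section TransitionFunctions.
Variables (R : realType) (S : countType) (p : R -> S -> S -> R).
Hypothesis pP : transition_function p.
Implicit Types (U g : S -> R) (A B : set S) (s t h : R) (x y : S).

Lemma transition_weight t x : 0 <= t -> summable_weight (p t x).
Proof.
move=> t0; split=> [y|]; first exact: transition_ge0.
by rewrite (transition_sum1 pP)// ltry.
Qed.

Lemma transition_massT t x : 0 <= t -> wmass (p t x) [set: S] = 1.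
Proof.
by move=> t0; apply: EFin_inj; rewrite (wmassE (transition_weight _ _))//
  (transition_sum1 pP).
Qed.

Lemma transition_mass_ge0 t x A : 0 <= t -> 0 <= wmass (p t x) A.
Proof. by move=> t0; apply: wsum_ge0 => //; exact: transition_weight. Qed.

Lemma transition_massC t x A : 0 <= t -> wmass (p t x) (~` A) = 1 - wmass (p t x) A.
Proof.
move=> t0; apply/eqP; rewrite eq_sym subr_eq -(transition_massT x t0) -wsumD.
- apply/eqP; congr wsum; apply/funext => y.
  by rewrite in_setT in_setC; case: (y \in A); rewrite ?add0r ?addr0.
- exact: transition_weight.
- exact: bounded_nonneg_indic.
- exact: bounded_nonneg_indic.
Qed.

Lemma transition_mass_le1 t x A : 0 <= t -> wmass (p t x) A <= 1.
Proof.
by move=> t0; rewrite -subr_ge0 -transition_massC// transition_mass_ge0.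
Qed.

Lemma le_transition_mass t x A B : 0 <= t -> A `<=` B ->
  wmass (p t x) A <= wmass (p t x) B.
Proof.
move=> t0 AB; apply: le_wsum => [|y||y]; first exact: transition_weight.
- exact: ler0n.
- exact: bounded_nonneg_indic.
- by have [/set_mem/AB/mem_set->|_] := boolP (y \in A).
Qed.

Lemma transition_le1 t x y : 0 <= t -> p t x y <= 1.
Proof.
move=> t0; rewrite -(wmass_set1 (transition_weight x t0)).
exact: transition_mass_le1.
Qed.

Lemma transition_bounded t y : 0 <= t -> bounded_nonneg (fun x => p t x y).
Proof.
by move=> t0; exists 1 => x; rewrite (transition_ge0 pP)//= transition_le1.
Qed.

Lemma transition_wsum_bounded t g : 0 <= t -> bounded_nonneg g ->
  bounded_nonneg (fun x => wsum (p t x) g).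
Proof.
move=> t0 gP; have [K gK] := gP; exists `|K| => x; apply/andP; split.
  apply: wsum_ge0; first exact: transition_weight.
  by move=> y; have /andP[] := gK y.
have w := transition_weight x t0.
rewrite -[leRHS]mulr1 -(transition_massT x t0) -wsumZ//;
  last exact: bounded_nonneg_indic.
apply: le_wsum => // [y||y].
- by have /andP[] := gK y.
- by apply: bounded_nonnegZ => //; exact: bounded_nonneg_indic.
by rewrite in_setT mulr1 (le_trans _ (ler_norm _))//; have /andP[] := gK y.
Qed.

(* The image of the measure [U] under the transition kernel at time [t]. *)
Definition transport U t : S -> R := fun y => wsum U (fun x => p t x y).

Section Transport.
Variable U : S -> R.
Hypothesis UP : summable_weight U.

Lemma transport_esum t g : 0 <= t -> bounded_nonneg g ->
  (\esum_(y in [set: S]) (transport U t y * g y)%:E = (wsum U (fun x =>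
    wsum (p t x) g))%:E)%E.
Proof.
move=> t0 gP; have [U0 _] := UP; have [K gK] := gP.
have g0 y : 0 <= g y by have /andP[] := gK y.
rewrite wsumE//; last exact: transition_wsum_bounded.
transitivity (\esum_(y in [set: S]) \esum_(x in [set: S]) (U x * (p t x y * g y))%:E)%E.
  apply: eq_esum => y _; rewrite EFinM wsumE//; last exact: transition_bounded.
  rewrite muleC -esumZl//; last first.
    by move=> x; rewrite lee_fin mulr_ge0// (transition_ge0 pP).
  by apply: eq_esum => x _; rewrite -EFinM mulrC mulrA.
rewrite esum_exchange; last first.
  by move=> x y; rewrite lee_fin !mulr_ge0// (transition_ge0 pP).
apply: eq_esum => x _; rewrite EFinM (wsumE (transition_weight _ _))// -esumZl//.
by move=> y; rewrite lee_fin mulr_ge0// (transition_ge0 pP).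
Qed.

Lemma transport_weight t : 0 <= t -> summable_weight (transport U t).
Proof.
move=> t0; split=> [y|].
  by apply: wsum_ge0 => // x; exact: transition_ge0.
have := transport_esum t0 (bounded_nonneg_cst S ler01).
by under eq_esum do rewrite mulr1; move=> ->; rewrite ltry.
Qed.

Lemma wsum_transport t g : 0 <= t -> bounded_nonneg g ->
  wsum (transport U t) g = wsum U (fun x => wsum (p t x) g).
Proof.
move=> t0 gP; apply: EFin_inj; rewrite -transport_esum// wsumE//.
exact: transport_weight.
Qed.

Lemma transport0 : transport U 0 = U.
Proof.
apply/funext => y; rewrite -(wmass_set1 UP); congr wsum; apply/funext => x.
by rewrite (transition_id pP) mem_set1E.
Qed.

Lemma transportD s t : 0 <= s -> 0 <= t ->
  transport (transport U s) t = transport U (s + t).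
Proof.
move=> s0 t0; apply/funext => y; rewrite /transport wsum_transport//; last first.
  exact: transition_bounded.
congr wsum; apply/funext => x; apply: EFin_inj.
by rewrite (wsumE (transition_weight _ _))// ?(transition_comp pP)//;
  exact: transition_bounded.
Qed.


End Transport.
End TransitionFunctions.

Lemma wmass_set0 (R : realType) (S : choiceType) (U : S -> R) : wmass U set0 = 0.
Proof. by rewrite /wmass /wsum esum1// => x _; rewrite in_set0 mulr0. Qed.


(* From [x], clock [j] rings at rate [r x j] and moves the chain to [tau x j]. *)
Section JumpChains.
Variables (R : realType) (S : countType) (p : R -> S -> S -> R).
Variables (J : finType) (r : S -> J -> R) (tau : S -> J -> S) (C : R).
Hypothesis r_ge0 : forall x j, 0 <= r x j.
Hypothesis C_ge0 : 0 <= C.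
Hypothesis r_le : forall x, \sum_j r x j <= C.
Let q x y := \sum_j r x j * (tau x j == y)%:R.
Hypothesis qp : jump_transition_function q p.
Implicit Types (U g : S -> R) (A B : set S) (s t h : R) (x y : S).

Let pP : transition_function p := jump_transition qp.

Definition jump_mass x A : R := \sum_j r x j * (tau x j \in A)%:R.

Lemma esum_rate x A : (\esum_(y in A) (q x y)%:E = (jump_mass x A)%:E)%E.
Proof.
rewrite /jump_mass -sumEFin; under eq_esum do rewrite -sumEFin.
rewrite esum_sum; last by move=> y j _ _; rewrite lee_fin mulr_ge0.
apply: eq_bigr => j _; rewrite (esumID [set tau x j]); last first.
  by move=> y _; rewrite lee_fin mulr_ge0.
rewrite [X in (_ + X)%E]esum1 ?adde0; last first.
  by move=> y [_ /= /eqP]; rewrite eq_sym => /negbTE->; rewrite mulr0.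
rewrite esum_mkcondl esum_set1.
  by rewrite eqxx mulr1; case: ifP => _; rewrite ?mulr1 ?mulr0.
by case: ifP => _; rewrite lee_fin ?mulr_ge0.
Qed.

Lemma exit_rate x : (1 - p h x x) / h @[h --> 0^'+] --> jump_mass x [set y | y != x].
Proof.
have := @jump_total_rate _ _ _ _ qp x; rewrite esum_rate.
by move=> /fine_cvg.
Qed.

Lemma jump_mass_le x A : jump_mass x A <= C.
Proof.
apply: le_trans (r_le x); apply: ler_sum => j _.
by rewrite ler_piMr// lern1 leq_b1.
Qed.

(* [1 - ab <= (1 - a) + (1 - b)] on [0, 1]: no bound on short times that is uniform
   in [x] is assumed, so it is extracted from the Chapman-Kolmogorov equation. *)
Lemma ler_holding_mul t x n : 0 <= t ->
  1 - p (n%:R * t) x x <= n%:R * (1 - p t x x).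
Proof.
move=> t0; elim: n => [|n IH].
  by rewrite !mul0r (transition_id pP) eqxx subrr.
have nt0 : 0 <= n%:R * t by rewrite mulr_ge0.
rewrite -natr1 !mulrDl !mul1r.
have : p (n%:R * t) x x * p t x x <= p (n%:R * t + t) x x.
  rewrite -lee_fin (transition_comp pP)//; apply: esum_ge.
  by exists [set x] => //; rewrite fsbig_set1.
have := transition_le1 pP x x nt0; have := transition_le1 pP x x t0.
have := transition_ge0 pP x x nt0; have := transition_ge0 pP x x t0.
move: IH; move: (p _ x x) (p t x x) (p (n%:R * t + t) x x) => a b c.
by nra.
Qed.

(** Cut [0, t] into n + 1 steps of length u: by [ler_holding_mul] the quotient (1 - p_t)/t is at
    most (1 - p_u)/u, which tends to the exit rate as n grows. *)
Lemma ler_holding t x : 0 <= t -> 1 - p t x x <= C * t.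
Proof.
rewrite le0r => /predU1P[->|t0].
  by rewrite (transition_id pP) eqxx subrr mulr0.
apply: le_trans (_ : jump_mass x [set y | y != x] * t <= _); last first.
  by rewrite ler_pM2r// jump_mass_le.
pose u n : R := t / n.+1%:R.
have u0 n : 0 < u n by rewrite divr_gt0.
have cu : (1 - p (u n) x x) / u n @[n --> \oo] --> jump_mass x [set y | y != x].
  have /cvg_at_rightP/(_ u) := exit_rate (x := x); apply; split => //.
  rewrite -[X in _ --> X](mulr0 t).
  by apply: cvgMl_tmp; exact: cvg_harmonic.
rewrite -ler_pdivrMr//; apply: (cvgr_to_ge cu); near=> n; rewrite ler_pdivrMr//.
have tu : n.+1%:R * u n = t by rewrite mulrC divfK.
have := ler_holding_mul x n.+1 (ltW (u0 n)); rewrite tu => /le_trans; apply.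
by rewrite -[X in _ <= _ * X]tu mulrCA divfK ?gt_eqF.
Unshelve. all: by end_near. Qed.

(** Several clocks may share a target: their rates add up in q, while the target must count once in
    a sum of [p h x y]; hence [undup]. *)
Let targets x A : seq S := [seq y <- undup [seq tau x j | j : J] | y \in A].

Let ler_targets h x A : 0 <= h ->
  \sum_(y <- targets x A) p h x y <= wmass (p h x) A.
Proof.
move=> h0; rewrite -lee_fin (wmassE (transition_weight pP x h0)) -sumEFin.
apply: esum_ge; exists [set` targets x A].
  split; first exact: finite_seq.
  by move=> y /=; rewrite mem_filter => /andP[/set_mem].
by rewrite fsbig_seq//= filter_uniq// undup_uniq.
Qed.

Let targets_rate x A : x \notin A ->
  (\sum_(y <- targets x A) p h x y) / h @[h --> 0^'+] --> jump_mass x A.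
Proof.
move=> xA; under eq_fun do rewrite mulr_suml.
have -> : jump_mass x A = \sum_(y <- targets x A) q x y.
  rewrite exchange_big /=; apply: eq_bigr => j _; rewrite -mulr_sumr; congr (_ * _).
  rewrite -natr_sum; congr (_%:R).
  have jT : (tau x j \in targets x A) = (tau x j \in A).
    by rewrite mem_filter mem_undup map_f ?andbT// mem_enum.
  rewrite -jT -big_mkcond /= sum1_count.
  transitivity (count_mem (tau x j) (targets x A)).
    by rewrite count_uniq_mem// filter_uniq// undup_uniq.
  by apply: eq_count => y /=; rewrite eq_sym.
rewrite /targets big_filter (_ : (fun h => _) = fun h =>
  \sum_(y <- undup [seq tau x j | j : J] | y \in A) p h x y / h); last first.
  by apply/funext => h; rewrite big_filter.
apply: cvg_big => [|y yA]; first exact: add_continuous.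
by apply: jump_rate qp _ _ _; apply: contraNneq xA => ->.
Qed.

Let indic_split x A y : x \notin A ->
  (y \in [set z | z != x])%:R =
  (y \in A)%:R + (y \in [set z | z != x] `\` A)%:R :> R.
Proof.
move=> xA; have [yA|yA] := boolP (y \in A).
  rewrite (_ : y \in _ `\` _ = false) ?addr0; last first.
    by apply/negP => /set_mem[_]; apply; exact: set_mem.
  by rewrite mem_set//=; apply: contraNneq xA => <-.
rewrite add0r; congr (nat_of_bool _)%:R; apply/idP/idP => /set_mem.
  by move=> yx; apply/mem_set; split => // /mem_set; exact/negP.
by move=> [yx _]; exact/mem_set.
Qed.

(* Scheffe's argument: finitely many targets give lower bounds for the rates into
   [A] and into its complement, and these add up to the total rate. *)
Lemma jump_rate_mass_notin x A : x \notin A ->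
  wmass (p h x) A / h @[h --> 0^'+] --> jump_mass x A.
Proof.
move=> xA; set B := [set y | y != x] `\` A.
have xB : x \notin B by apply/negP => /set_mem[/eqP].
have AB : jump_mass x A = jump_mass x [set y | y != x] - jump_mass x B.
  rewrite -sumrB; apply: eq_bigr => j _; rewrite -mulrBr; congr (_ * _).
  by rewrite (indic_split _ xA) addrK.
apply: (@squeeze_cvgr _ _ _ _ (fun h => (\sum_(y <- targets x A) p h x y) / h)
  (fun h => (1 - p h x x) / h - (\sum_(y <- targets x B) p h x y) / h)).
- near=> h; have h0 : 0 < h by near: h; exact: nbhs_right_gt.
  have w := transition_weight pP x (ltW h0).
  rewrite ler_pM2r ?invr_gt0// (ler_targets _ _ (ltW h0))//= -mulrBl ler_pM2r
    ?invr_gt0//.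
  rewrite lerBrDr; apply: le_trans (lerD (lexx _) (ler_targets _ _ (ltW h0))) _.
  rewrite -wsumD//; try exact: bounded_nonneg_indic.
  rewrite -(wmass_set1 w) -(transition_massC pP _ _ (ltW h0)) le_eqVlt; apply/orP; left.
  apply/eqP; congr wsum; apply/funext => y; rewrite -indic_split//.
  by congr (nat_of_bool (y \in _))%:R; apply/seteqP; split=> z /= /eqP.
- exact: targets_rate.
- by rewrite AB; apply: cvgB; [exact: exit_rate|exact: targets_rate].
Unshelve. all: by end_near. Qed.

(** For x in A the previous lemma is applied to the complement, whose mass is one minus that of
    A. *)
Lemma jump_rate_mass x A :
  (wmass (p h x) A - (x \in A)%:R) / h @[h --> 0^'+] -->
  \sum_j r x j * ((tau x j \in A)%:R - (x \in A)%:R).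
Proof.
have [xA|xA] := boolP (x \in A); last first.
  under eq_fun do rewrite subr0.
  by under eq_bigr do rewrite subr0; exact: jump_rate_mass_notin.
have xAC : x \notin ~` A by rewrite in_setC xA.
have -> : \sum_j r x j * ((tau x j \in A)%:R - true%:R) = - jump_mass x (~` A).
  rewrite -sumrN; apply: eq_bigr => j _; rewrite -mulrN in_setC.
  by case: (_ \in _); rewrite /= ?subrr ?oppr0// sub0r.
apply: cvg_trans (cvgN (jump_rate_mass_notin xAC)); apply: near_eq_cvg; near=> h.
have h0 : 0 < h by near: h; exact: nbhs_right_gt.
transitivity (- (wmass (p h x) (~` A) / h)) => //.
by rewrite (transition_massC pP _ _ (ltW h0)) -mulNr opprB.
Unshelve. all: by end_near. Qed.

(** Membership in A can only change if the chain is no longer at x, which has probability at most C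
    h. This bound is uniform in x and provides the domination below. *)
Lemma dist_mass_indic h x A : 0 <= h ->
  `|wmass (p h x) A - (x \in A)%:R| <= C * h.
Proof.
move=> h0; have w := transition_weight pP x h0.
have := ler_holding x h0; rewrite -(wmass_set1 w).
have [xA|xA] := boolP (x \in A).
  have : wmass (p h x) [set x] <= wmass (p h x) A.
    by apply: le_transition_mass => // y ->; exact: set_mem.
  have := transition_mass_le1 pP x A h0.
  move: (wmass _ _) (wmass _ _) => a b; rewrite mulr1n ler_norml => ? ? ?.
  by apply/andP; split; lra.
have : wmass (p h x) A <= wmass (p h x) (~` [set x]).
  by apply: le_transition_mass => // y yA /= yx; move: xA; rewrite -yx mem_set.
rewrite transition_massC// subr0 ger0_norm; last exact: transition_mass_ge0.
by move=> /le_trans; exact.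
Qed.

Section Forward.
Variables (U : S -> R) (A : set S).
Hypothesis UP : summable_weight U.

(** Integrates [dist_mass_indic] against the measure at time t, whose total mass is that of U. It
    yields the left continuity in [forward_equation]. *)
Lemma transport_mass_lipschitz t h : 0 <= t -> 0 <= h ->
  `|wmass (transport p U (t + h)) A - wmass (transport p U t) A| <=
  C * h * wmass U [set: S].
Proof.
move=> t0 h0; have wU := transport_weight pP UP t0.
have bA := bounded_nonneg_indic R A.
have bp := transition_wsum_bounded pP h0 bA.
have Ch0 : 0 <= C * h by rewrite mulr_ge0.
rewrite -transportD// [X in X - _]wsum_transport//.
have bT : bounded_nonneg (fun x : S => C * h * (x \in [set: S])%:R).
  by apply: bounded_nonnegZ => //; exact: bounded_nonneg_indic.
have -> : wmass U [set: S] = wmass (transport p U t) [set: S].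
  rewrite /wmass wsum_transport//; last exact: bounded_nonneg_indic.
  congr wsum; apply/funext => x; rewrite in_setT.
  by have := transition_massT pP x t0.
rewrite -wsumZ//; last exact: bounded_nonneg_indic.
have dist := dist_mass_indic _ A h0.
rewrite ler_norml; apply/andP; split.
  rewrite lerNl opprB lerBlDr -wsumD//; apply: le_wsum => // [|x].
    exact: bounded_nonnegD.
  by rewrite in_setT mulr1; have := dist x; rewrite ler_norml /wmass => /andP[];
  move: (_%:R) (wsum _ _) => a b; lra.
rewrite lerBlDr -wsumD//; apply: le_wsum => // [x||x].
- exact: transition_mass_ge0.
- exact: bounded_nonnegD.
by rewrite in_setT mulr1; have := dist x; rewrite ler_norml /wmass => /andP[];
  move: (_%:R) (wsum _ _) => a b; lra.
Qed.


Variables (I : finType) (c : I -> R) (B : I -> set S) (c0 : R).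
Hypothesis c_ge0 : forall i, 0 <= c i.
Hypothesis c0_ge0 : 0 <= c0.
(** The generator applied to the indicator of A, split into gains from the sets [B i] and a loss
    from A: the shape in which the equations for masses close. *)
Hypothesis generator_indic : forall x,
  \sum_j r x j * ((tau x j \in A)%:R - (x \in A)%:R) =
  \sum_i c i * (x \in B i)%:R - c0 * (x \in A)%:R.

Lemma forward_equation0 (V : S -> R) : summable_weight V ->
  (wmass (transport p V h) A - wmass V A) / h @[h --> 0^'+] -->
  \sum_i c i * wmass V (B i) - c0 * wmass V A.
Proof.
move=> VP.
(* [wsum] wants nonnegative integrands, and the difference quotient lies in [-C, C]: shifting by C
   puts it in [0, 2C]. *)
pose psi h x := (wmass (p h x) A - (x \in A)%:R) / h + C.
pose psi0 x := \sum_i c i * (x \in B i)%:R - c0 * (x \in A)%:R + C.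
have psi_lim x : psi h x @[h --> 0^'+] --> psi0 x.
  apply: cvgD; last exact: cvg_cst.
  by rewrite -generator_indic; exact: jump_rate_mass.
have psiP h x : 0 < h -> 0 <= psi h x <= C *+ 2.
  move=> h0; have := dist_mass_indic x A (ltW h0).
  rewrite -ler_pdivrMr// -[X in _ / X](gtr0_norm h0) -normf_div ler_norml => /andP[? ?].
  by rewrite /psi; apply/andP; split; lra.
have psi_near : \forall h \near 0^'+, forall x, 0 <= psi h x <= C *+ 2.
  near=> h => x; apply: psiP; near: h; exact: nbhs_right_gt.
have psi0P : bounded_nonneg psi0.
  exists (C *+ 2) => x; apply/andP; split.
    by apply: (cvgr_to_ge (psi_lim x)); apply: filterS psi_near => h /(_ x)/andP[].
  by apply: (cvgr_to_le (psi_lim x)); apply: filterS psi_near => h /(_ x)/andP[].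
have lim : wsum V (psi h) @[h --> 0^'+] --> wsum V psi0.
  exact: wsum_dominated psi_near psi_lim.
have bA := bounded_nonneg_indic R A.
have bT := bounded_nonneg_indic R [set: S].
have e0 : wsum V psi0 =
    \sum_i c i * wmass V (B i) - c0 * wmass V A + C * wmass V [set: S].
  have bB i : bounded_nonneg (fun x => c i * (x \in B i)%:R).
    by apply: bounded_nonnegZ => //; exact: bounded_nonneg_indic.
  have [bS eS] := wsum_sum VP (index_enum I) bB.
  rewrite addrAC; apply/eqP; rewrite eq_sym subr_eq; apply/eqP.
  rewrite -!wsumZ// -wsumD//; last exact: bounded_nonnegZ.
  under eq_bigr do rewrite -(wsumZ VP (c_ge0 _) (bounded_nonneg_indic R _)).
  rewrite -eS -wsumD//; last exact: bounded_nonnegZ.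
  by congr wsum; apply/funext => x; rewrite /psi0 in_setT mulr1 addrAC subrK.
rewrite -[X in _ --> X](addrK (C * wmass V [set: S])) -e0.
apply: cvg_trans (cvgB lim (cvg_cst (C * wmass V [set: S]))); apply: near_eq_cvg;
  near=> h.
have h0 : 0 < h by near: h; exact: nbhs_right_gt.
have bpsi : bounded_nonneg (psi h) by exists (C *+ 2) => x; exact: psiP.
change (wsum V (psi h) - C * wmass V [set: S] =
  (wmass (transport p V h) A - wmass V A) / h).
suff : h * wsum V (psi h) + wmass V A =
  wmass (transport p V h) A + C * h * wmass V [set: S].
  move=> e; have -> : wsum V (psi h) =
    (wmass (transport p V h) A + C * h * wmass V [set: S] - wmass V A) / h.
    by rewrite -e addrK mulrAC divff ?mul1r ?gt_eqF.
  by field; rewrite gt_eqF.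
have bp := transition_wsum_bounded pP (ltW h0) bA.
have Ch0 : 0 <= C * h by rewrite mulr_ge0// ltW.
have hW := ltW h0.
have b1 := bounded_nonnegZ hW bpsi; have b2 := bounded_nonnegZ Ch0 bT.
rewrite /wmass wsum_transport// -(wsumZ VP hW bpsi) -(wsumZ VP Ch0 bT).
rewrite -(wsumD VP b1 bA) -(wsumD VP bp b2).
congr wsum; apply/funext => x; rewrite /psi in_setT mulr1 /wmass.
by field; rewrite gt_eqF.
Unshelve. all: by end_near. Qed.

(** By [transportD], the right derivative at t is the one at 0 for the chain restarted from
    [transport p U t]. *)
Theorem forward_equation :
  right_derivative (fun t => wmass (transport p U t) A)
    (fun t => \sum_i c i * wmass (transport p U t) (B i)
       - c0 * wmass (transport p U t) A).
Proof.
split=> t t0.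
  have := forward_equation0 (transport_weight pP UP t0).
  apply: cvg_trans; apply: near_eq_cvg; near=> h.
  by rewrite transportD// ltW//; near: h; exact: nbhs_right_gt.
pose K := C * wmass U [set: S].
have : wmass (transport p U t) A + K * (t - s) @[s --> t^'-] -->
    wmass (transport p U t) A + K * (t - t).
  apply: cvgD; first exact: cvg_cst.
  apply: cvgMl_tmp; apply: cvgB; first exact: cvg_cst.
  exact: cvg_at_left_filter (@cvg_id _ _).
have : wmass (transport p U t) A - K * (t - s) @[s --> t^'-] -->
    wmass (transport p U t) A - K * (t - t).
  apply: cvgB; first exact: cvg_cst.
  apply: cvgMl_tmp; apply: cvgB; first exact: cvg_cst.
  exact: cvg_at_left_filter (@cvg_id _ _).
rewrite subrr mulr0 subr0 addr0; apply: squeeze_cvgr; near=> s.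
have s0 : 0 <= s by apply: ltW; near: s; exact: nbhs_left_gt.
have st : 0 <= t - s by rewrite subr_ge0 ltW//; near: s; exact: nbhs_left_lt.
have := transport_mass_lipschitz s0 st; rewrite subrKC mulrAC -/K ler_norml.
by move=> /andP[? ?]; apply/andP; split; lra.
Unshelve. all: by end_near. Qed.

End Forward.
End JumpChains.

(** * Push-block moves of arrays *)

Section Arrays.
Local Open Scope nat_scope.
Implicit Types (c g z : nat -> nat -> nat) (k n j m p i : nat).

Definition interlacing k g := forall n j, n < k -> j <= n ->
  g n.+1 j <= g n j < g n.+1 j.+1.

Definition agree k c g : bool :=
  [forall n : 'I_k.+1, forall j : 'I_n.+1, c n j == g n j].

Lemma agreeP k c g :
  reflect (forall n j, n <= k -> j <= n -> c n j = g n j) (agree k c g).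
Proof.
apply: (iffP forallP) => [cg n j nk jn|cg n].
  have nk' : n < k.+1 by [].
  have jn' : j < (Ordinal nk').+1 by [].
  by have /forallP/(_ (Ordinal jn'))/eqP := cg (Ordinal nk').
by apply/forallP => j; apply/eqP/cg; rewrite -ltnS.
Qed.

Lemma interlacing_sorted k g n i j : interlacing k g -> n <= k ->
  i < j -> j <= n -> g n i < g n j.
Proof.
move=> gP nk ij; elim: j ij => // j IH ij jn.
have gj : g n j < g n j.+1.
  by case: n nk jn {IH} => // n nk jn; have := gP n j nk jn; lia.
move: ij; rewrite ltnS leq_eqVlt => /orP[/eqP->//|ij].
by apply: ltn_trans (IH ij (ltnW jn)) gj.
Qed.

(** Closed form of the recursion: m is the number of pushed particles, those that move lie on the
    diagonal through (n, j), and p + j = i + n says that (p, i) is on it. The last two clauses say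
    why each push occurs and why the cascade stops. *)
Lemma push_spec a c n j : exists m, [/\ m <= a,
  (forall p i, push a c n j p i = c p i + ((n <= p <= n + m) && (p + j == i + n))),
  (forall i, i < m -> (c (n + i) (j + i)).+1 = c (n + i).+1 (j + i).+1) &
  (m < a -> (c (n + m) (j + m)).+1 <> c (n + m).+1 (j + m).+1)].
Proof.
elim: a c n j => [|a IH] c n j /=.
  exists 0; split => // p i; rewrite /move_right; congr (_ + nat_of_bool _).
  by apply/idP/idP; lia.
have mE : move_right c n j n j = (c n j).+1 by rewrite /move_right !eqxx addn1.
have mS p i : n < p -> move_right c n j p i = c p i.
  by rewrite /move_right; lia.
case: eqP; rewrite mE mS// => e; last first.
  exists 0; split => // [p i|_]; last by rewrite !addn0.
  rewrite /move_right; congr (_ + nat_of_bool _).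
  by apply/idP/idP; lia.
have [m [ma pE cE cN]] := IH (move_right c n j) n.+1 j.+1.
exists m.+1; split => //.
- by move=> p i; rewrite pE /move_right -addnA; congr (_ + _); lia.
- case=> [|i] im; first by rewrite !addn0.
  by have := cE i im; rewrite !mS ?addSnnS//; clear; lia.
- by move=> ma'; have := cN ma'; rewrite !mS ?addSnnS//; clear; lia.
Qed.

(* If the last particle moved on the way to [g] is (n, j), then the particles that
   moved are the [depth g n j].+1 particles (n, j), (n - 1, j - 1), ...: each of
   them but the last was pushed by the next one, which now sits one step behind it.
   [retract g n j] undoes this move, and [can_retract k g n j] says when the result
   is a configuration of the levels 0, ..., k. *)
Fixpoint depth g n j : nat :=
  match n, j with
  | n'.+1, j'.+1 => if (g n' j').+1 == g n j then (depth g n' j').+1 else 0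
  | _, _ => 0
  end.

(** The second clause forbids extending the run downwards along its diagonal, so that m is
    determined by the upper end of the run: it is its [depth]. *)
Definition chain g n j m :=
  (forall i, i < m -> (g (n + i) (j + i)).+1 = g (n + i).+1 (j + i).+1) /\
  (0 < j -> (g n.-1 j.-1).+1 <> g n j).

Lemma depth_chain g n j : j <= n -> depth g n j <= j /\
  chain g (n - depth g n j) (j - depth g n j) (depth g n j).
Proof.
elim: n j => [|n IH] [|j] //= jn; try by split => //; split.
case: eqP => e; last by split => //; split => // _; rewrite !subn0.
have [dj [dE dN]] := IH j jn; split => //; rewrite !subSS; split => // i.
rewrite ltnS leq_eqVlt => /orP[/eqP->|]; last exact: dE.
by rewrite !subnK // (leq_trans dj).
Qed.

Lemma chain_depth g n j m : j <= n -> chain g n j m -> depth g (n + m) (j + m) = m.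
Proof.
move=> jn [gE gN]; elim: m gE => [|m IH] gE.
  rewrite !addn0; case: n j jn gN {gE} => [|n] [|j] //= _ gN.
  by case: eqP => // /gN; case.
by rewrite !addnS /= gE// eqxx IH// => i im; apply: gE; rewrite ltnS ltnW.
Qed.

Definition can_retract k g n j : bool :=
  if n < k then g n.+1 j < g n j
  else (0 < g n j) && ((j == 0) || ((g n j.-1).+1 < g n j)).

Definition retract g n j : nat -> nat -> nat :=
  fun p i => g p i - ((n - depth g n j <= p <= n) && (p + j == i + n)).

(** With [retract_push] this matches the unblocked rings that turn z into g on the levels up to k
    with the retractions of g that give z. *)
Lemma push_retract N k z g n0 j0 : interlacing N z -> interlacing k g -> k <= N ->
  n0 <= k -> j0 <= n0 -> ~~ blocked z n0 j0 ->
  agree k (push (N - n0) z n0 j0) g ->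
  exists n j, [/\ n <= k, j <= n, can_retract k g n j,
    agree k z (retract g n j) &
    [/\ n0 = n - depth g n j, j0 = j - depth g n j & z n0 j0 =
      g n j - (depth g n j).+1]].
Proof.
move=> zP gP kN n0k j0n nb /agreeP ag.
have [m [ma pE zE zN]] := push_spec (N - n0) z n0 j0.
(* The push may continue above level k, where g is not constrained; m' counts the pushes visible up
   to level k. *)
have [m' [m'm m'k m'E]] : exists m', [/\ m' <= m, n0 + m' <= k & n0 + m' = k \/ m' = m].
  have [?|?] := leqP m (k - n0); first by exists m; split; lia.
  by exists (k - n0); split; lia.
have {}pE p i : p <= k -> i <= p -> g p i =
  z p i + ((n0 <= p <= n0 + m') && (p + j0 == i + n0)).
  move=> pk ip; rewrite -ag// pE; congr (_ + nat_of_bool _).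
  by clear -pk m'm m'E; lia.
have gz i : i <= m' -> g (n0 + i) (j0 + i) = (z (n0 + i) (j0 + i)).+1.
  by clear -pE m'k j0n => im; rewrite pE; lia.
have zE' i : i < m' -> (z (n0 + i) (j0 + i)).+1 = z (n0 + i).+1 (j0 + i).+1.
  by move=> im; apply: zE; apply: leq_trans im m'm.
have zk n j : n < k -> j <= n -> z n.+1 j <= z n j < z n.+1 j.+1.
  by move=> nk; apply: zP; apply: leq_trans kN.
have ch : chain g n0 j0 m'.
  split=> [i im|j00].
    rewrite -!addnS gz ?(ltnW im)// gz//; congr _.+1; rewrite !addnS; exact: zE'.
  (* The particle below (n0, j0) on the diagonal did not move and was strictly to the left of it, so
     it is now at least two sites behind: the chain starts at (n0, j0). *)
  have := gz 0 (leq0n _); rewrite !addn0 => ->.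
  have n00 : 0 < n0 by apply: leq_trans j0n.
  have := zk n0.-1 j0.-1; rewrite !prednK// => /(_ n0k) zz.
  rewrite pE; last 2 first.
  - by clear -n0k; lia.
  - by clear -j0n n00 j00; lia.
  have /andP[_] := zz ltac:(clear -j0n n00 j00; lia).
  by clear -n00; lia.
have dE := chain_depth j0n ch.
have nk_eq : n0 + m' < k -> m' = m by clear -m'E; lia.
have j'n : j0 + m' <= n0 + m' by rewrite leq_add2r.
exists (n0 + m'), (j0 + m'); rewrite dE !addnK; split => //.
- rewrite /can_retract; case: ltnP => nk.
    have := zk _ _ nk j'n; rewrite gz// pE//; last by rewrite ltnW.
    by clear; lia.
  have nk' : n0 + m' = k by apply/eqP; rewrite eqn_leq m'k.
  rewrite gz//=; have [//|j'0] := posnP (j0 + m'); rewrite /=.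
  have := @interlacing_sorted N z (n0 + m') (j0 + m').-1 (j0 + m') zP.
  rewrite pE//; last by clear -j'n; lia.
  move=> /(_ (leq_trans m'k kN)) zs.
  have := zs ltac:(clear -j'0; lia) j'n.
  by clear -j'0; lia.
- apply/agreeP => p i pk ip; rewrite /retract dE !addnK pE//.
  by clear; lia.
- split=> //.
  have zm i : i <= m' -> z n0 j0 + i = z (n0 + i) (j0 + i).
    elim: i => [|i IH] im; first by rewrite !addn0.
    by rewrite addnS IH ?(ltnW im)// zE' ?addnS.
  by rewrite gz// -zm//; clear; lia.
Qed.

Lemma chain_val g n j m i : chain g n j m -> i <= m -> g (n + i) (j + i) = g n j + i.
Proof.
move=> [gE _]; elim: i => [|i IH] im; first by rewrite !addn0.
by rewrite !addnS -gE// IH ?(ltnW im).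
Qed.

(** [can_retract] tests the last particle only; the rest of the chain follows by induction
    downwards. If particle i sat on its lower bound, the left neighbour of particle i + 1 in its row
    would be exactly one site behind it. Interlacing with the next level, or the test at level k,
    excludes this. *)
Lemma can_retract_chain k g n j m : interlacing k g -> n + m <= k -> j <= n ->
  chain g n j m -> can_retract k g (n + m) (j + m) ->
  (forall i, i <= m -> n + i < k -> g (n + i).+1 (j + i) < g (n + i) (j + i)) /\
  0 < g n j.
Proof.
move=> gP nmk jn ch v.
have P i : i <= m -> n + i < k -> g (n + i).+1 (j + i) < g (n + i) (j + i).
  move=> im; have [a ->] : exists a, i = m - a by exists (m - i); rewrite subKn.
  elim: a {i im} => [|a IH] nk.
    by move: nk v; rewrite subn0 /can_retract => ->.
  have [am|ma] := leqP m a.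
    by have /eqP E : m - a.+1 == m - a by [clear -am; lia]; move: nk; rewrite E;
      exact: IH.
  have Ei : m - a = (m - a.+1).+1 by clear -ma; lia.
  move: nk IH; rewrite Ei; move: (m - a.+1) Ei => i Ei nk IH.
  have im : i < m by clear -Ei ma; lia.
  have c1 := chain_val ch (ltnW im); have c2 := chain_val ch im.
  have jin : j + i <= n + i by rewrite leq_add2r.
  have /andP[g1 g2] := gP _ _ nk jin.
  rewrite ltn_neqAle g1 andbT; apply/eqP => e.
  have [nk1|nk1] := ltnP (n + i.+1) k.
    have := IH nk1; rewrite addnS in nk1 *.
    have := gP _ _ nk1 (leqW jin); rewrite e c1 !addnS.
    rewrite !addnS in c2; rewrite c2.
    by clear; lia.
  have im1 : i.+1 = m by clear -nmk nk1 im; lia.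
  have := v; rewrite -im1 /can_retract ltnNge nk1 /= addnS /=.
  rewrite !addnS in c2 *; rewrite c2 /= e c1.
  by clear; lia.
split => //.
have [nk|nk] := ltnP n k.
  by have := P 0 (leq0n _); rewrite !addn0 => /(_ nk); exact: leq_trans.
have m0 : m = 0 by clear -nmk nk; lia.
by move: v; rewrite m0 !addn0 /can_retract ltnNge nk => /andP[].
Qed.

(** Lower bounds survive by [can_retract_chain]. A strict upper bound is at risk only where the
    bounding particle moves back and the bounded one does not, that is at the bottom of the chain,
    and there maximality of the chain leaves a free site. *)
Lemma retract_interlacing k g n j : interlacing k g -> n <= k -> j <= n ->
  can_retract k g n j ->
  interlacing k (retract g n j) /\ depth g n j < g n j.
Proof.
move=> gP nk jn v; have [dj ch] := depth_chain g jn.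
have [n0 [j0 [nE jE]]] : exists n0 j0, n = n0 + depth g n j /\ j = j0 + depth g n j.
  exists (n - depth g n j), (j - depth g n j).
  by rewrite !subnK// (leq_trans dj).
rewrite /retract; move: (depth g n j) nE jE ch {dj} v nk jn => m -> ->.
rewrite !addnK => ch v nk; rewrite leq_add2r => jn.
have [P g0] := can_retract_chain gP nk jn ch v; split; last first.
  by rewrite (chain_val ch)// -add1n leq_add2r.
move=> p i pk ip; have /andP[g1 g2] := gP p i pk ip.
have on p' i' : (n0 <= p' <= n0 + m) && (p' + (j0 + m) == i' + (n0 + m)) ->
    exists2 a, a <= m & p' = n0 + a /\ i' = j0 + a.
  move=> H; exists (p' - n0); clear -H jn; lia.
case: (boolP (_ && (p + _ == _))) => [/on[a am [pE iE]]|off].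
  have := P a am; rewrite -pE -iE => /(_ pk) g3.
  apply/andP; split; first by clear -g3; lia.
  by clear -g3 g2; lia.
rewrite subn0; apply/andP; split; first by clear -g1; lia.
case: (boolP (_ && (p.+1 + _ == _))) => [on1|_]; last by rewrite subn0.
have [a am [pE iE]] := on _ _ on1.
have a0 : a = 0 by clear -off pE iE am; lia.
move: pE iE; rewrite a0 !addn0 => pE iE.
have [_] := ch; rewrite -pE -iE => /(_ isT) /= ne.
by clear -ne g2; lia.
Qed.

(** In z the first particle is one step behind a site that g allows, so it is not blocked. The chain
    occupies consecutive sites, so the push runs through it; if n < k it stops at (n, j), since (n +
    1, j + 1) did not move and lies strictly to the right of (n, j) in g. *)
Lemma retract_push N k z g n j : interlacing N z -> interlacing k g -> k <= N ->
  n <= k -> j <= n -> can_retract k g n j -> agree k z (retract g n j) ->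
  let n0 := n - depth g n j in let j0 := j - depth g n j in
  [/\ ~~ blocked z n0 j0, agree k (push (N - n0) z n0 j0) g &
      z n0 j0 = g n j - (depth g n j).+1].
Proof.
move=> zP gP kN nk jn v /agreeP ag /=; have [dj ch] := depth_chain g jn.
have [n0 [j0 [nE jE]]] : exists n0 j0, n = n0 + depth g n j /\ j = j0 + depth g n j.
  exists (n - depth g n j), (j - depth g n j).
  by rewrite !subnK// (leq_trans dj).
move: ag; rewrite /retract; move: (depth g n j) nE jE ch {dj} v nk jn => m -> ->.
rewrite !addnK => ch v nk; rewrite leq_add2r => jn ag.
have [P g0] := can_retract_chain gP nk jn ch v.
have zc i : i <= m -> z (n0 + i) (j0 + i) = g n0 j0 + i - 1.
  move=> im; rewrite ag ?leq_add2r//; last by clear -im nk; lia.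
  by rewrite (chain_val ch im); clear -im; lia.
split.
- rewrite /blocked; apply/negP => /andP[jn0 /eqP].
  have := zc 0 (leq0n _); rewrite !addn0 => ->.
  rewrite ag; last 2 first.
  + by clear -nk; lia.
  + by clear -jn0; lia.
  have n00 : 0 < n0 by apply: leq_ltn_trans jn0.
  have := gP n0.-1 j0; rewrite prednK// => /(_ _ _)/andP[||+ _].
  + by clear -nk n00; lia.
  + by clear -jn0; lia.
  by clear -g0 n00; lia.
- have [m1 [m1N pE zE zN]] := push_spec (N - n0) z n0 j0.
  have mm1 : m <= m1.
    rewrite leqNgt; apply/negP => m1m.
    apply: zN; first by clear -m1m nk kN; lia.
    rewrite -!addnS zc ?(ltnW m1m)// zc//.
    by clear -g0; lia.
  have m1m : n0 + m < k -> m1 = m.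
    move=> nmk; apply/eqP; rewrite eqn_leq mm1 andbT leqNgt; apply/negP => ltm.
    have := zE m ltm; rewrite zc// ag; last 2 first.
    + by clear -nmk; lia.
    + by rewrite ltnS leq_add2r.
    have /andP[_] := gP _ _ nmk (ltac:(by rewrite leq_add2r) : j0 + m <= n0 + m).
    rewrite (chain_val ch)//.
    by clear -g0; lia.
  apply/agreeP => p i pk ip; rewrite pE ag//.
  case: (boolP (_ && (p + (j0 + m) == _))) => [on|off].
    have ge1 : 0 < g p i.
      have -> : p = n0 + (p - n0) by clear -on; lia.
      have -> : i = j0 + (p - n0) by clear -on jn; lia.
      by rewrite (chain_val ch); [clear -g0; lia|clear -on; lia].
    by clear -on ge1 mm1; lia.
  have : n0 + m < k -> m1 = m := m1m.
  by clear -off pk nk; lia.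
- have := zc 0 (leq0n _); rewrite !addn0 => ->.
  by rewrite (chain_val ch)//; clear; lia.
Qed.
End Arrays.

(** * Sums over triangular index sets *)

Section TriangularSums.
Variable R : realType.
Implicit Types (F : nat -> nat -> R) (k : nat).

Lemma eq_triangle k F F' :
  (forall n j, (n <= k)%N -> (j <= n)%N -> F n j = F' n j) ->
  \sum_(n < k.+1) \sum_(j < n.+1) F n j = \sum_(n < k.+1) \sum_(j < n.+1) F' n j.
Proof.
move=> FF'; apply: eq_bigr => n _; apply: eq_bigr => j _.
by apply: FF'; rewrite -ltnS.
Qed.

Lemma triangle_sum0 k F : (forall n j, (n <= k)%N -> (j <= n)%N -> F n j = 0) ->
  \sum_(n < k.+1) \sum_(j < n.+1) F n j = 0.
Proof.
by move=> /eq_triangle->; rewrite big1// => n _; rewrite big1.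
Qed.

Lemma triangle_sum1 k F n0 j0 : (n0 <= k)%N -> (j0 <= n0)%N ->
  (forall n j, (n <= k)%N -> (j <= n)%N -> F n j != 0 -> n = n0 /\ j = j0) ->
  \sum_(n < k.+1) \sum_(j < n.+1) F n j = F n0 j0.
Proof.
move=> n0k j0n F0; have n0k' : (n0 < k.+1)%N by [].
have j0n' : (j0 < (Ordinal n0k').+1)%N by [].
rewrite (bigD1 (Ordinal n0k'))//= (bigD1 (Ordinal j0n'))//=.
rewrite big1 => [|j /eqP jj0].
  rewrite addr0 big1 ?addr0// => n /eqP nn0; rewrite big1// => j _.
  have jn : (j <= n)%N by rewrite -ltnS.
  have nk : (n <= k)%N by rewrite -ltnS.
  by apply/eqP/negPn/negP => /(F0 n j nk jn)[e _]; apply: nn0; exact: val_inj.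
have jn : (j <= n0)%N by rewrite -ltnS.
by apply/eqP/negPn/negP => /(F0 n0 j n0k jn)[_ e]; apply: jj0; exact: val_inj.
Qed.
End TriangularSums.

(** * Weights of patterns and the balance of rates *)

Section Weights.
Variables (R : realType) (lambda : nat -> R).
Hypothesis lambda_gt0 : forall x, 0 < lambda x.
Implicit Types (g z : nat -> nat -> nat) (k n j : nat).

Definition pattern_weight k g : R :=
  \prod_(n < k) \prod_(j < n.+1) (lambda (g n j))^-1.

Lemma pattern_weight_gt0 k g : 0 < pattern_weight k g.
Proof.
by apply: prodr_gt0 => n _; apply: prodr_gt0 => j _; rewrite invr_gt0.
Qed.

Lemma eq_pattern_weight k g g' :
  (forall n j, (n < k)%N -> (j <= n)%N -> g n j = g' n j) ->
  pattern_weight k g = pattern_weight k g'.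
Proof.
move=> gg'; apply: eq_bigr => n _; apply: eq_bigr => j _.
by rewrite gg'// -ltnS.
Qed.

Lemma pattern_weight_upd k g g' n0 j0 : (n0 < k)%N -> (j0 <= n0)%N ->
  (forall n j, (n < k)%N -> (j <= n)%N -> n <> n0 \/ j <> j0 -> g' n j = g n j) ->
  pattern_weight k g' * lambda (g' n0 j0) = pattern_weight k g * lambda (g n0 j0).
Proof.
move=> n0k j0n gg'.
have j0n' : (j0 < (Ordinal n0k).+1)%N by [].
rewrite /pattern_weight.
rewrite (bigD1 (Ordinal n0k))//= (bigD1 (Ordinal j0n'))//=.
rewrite [in RHS](bigD1 (Ordinal n0k))//= [in RHS](bigD1 (Ordinal j0n'))//=.
rewrite mulrC !mulrA divff ?gt_eqF// [RHS]mulrC !mulrA divff ?gt_eqF//.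
congr (_ * _ * _).
  apply: eq_bigr => j /eqP jj0; rewrite gg'// -1?ltnS//; right => e.
  by apply: jj0; exact: val_inj.
apply: eq_bigr => n /eqP nn0; apply: eq_bigr => j _; rewrite gg'// -1?ltnS//; left => e.
by apply: nn0; exact: val_inj.
Qed.

(* The particles of the chain occupy consecutive sites, so that the quotient of the
   two weights telescopes. *)
Lemma pattern_weight_retract k g n j : interlacing k g -> (n <= k)%N -> (j <= n)%N ->
  can_retract k g n j ->
  pattern_weight k (retract g n j) * lambda (g n j - (depth g n j).+1)%N =
  pattern_weight k g * lambda (if (n < k)%N then g n j else (g n j).-1).
Proof.
move=> gP nk jn v; have [_ dg] := retract_interlacing gP nk jn v.
have [dj ch] := depth_chain g jn.
have [n0 [j0 [nE jE]]] : exists n0 j0,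
  (n = n0 + depth g n j)%N /\ (j = j0 + depth g n j)%N.
  exists (n - depth g n j)%N, (j - depth g n j)%N.
  by rewrite !subnK// (leq_trans dj).
rewrite /retract; move: (depth g n j) nE jE ch {dj v} dg nk jn => m -> ->.
rewrite !addnK => ch dg nk; rewrite leq_add2r => jn.
have gv := chain_val ch; rewrite gv// in dg *.
have b0 : (0 < g n0 j0)%N by clear -dg; lia.
(* [G a] is g after the lowest a particles of the chain have moved back; each further one replaces a
   single factor of the weight. *)
pose G a p i : nat := (g p i - ((n0 <= p < n0 + a) && (p + j0 == i + n0)))%N.
have GE a : (a <= m.+1)%N -> (n0 + a <= k)%N ->
    pattern_weight k (G a) * lambda (g n0 j0).-1 =
    pattern_weight k g * lambda ((g n0 j0).-1 + a)%N.
  elim: a => [|a IH] am ak.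
    rewrite addn0; congr (_ * _); apply: eq_pattern_weight => p i _ _.
    by rewrite /G; clear; lia.
  rewrite addnS in ak.
  have ja : (j0 + a <= n0 + a)%N by rewrite leq_add2r.
  have := @pattern_weight_upd k (G a) (G a.+1) (n0 + a) (j0 + a) ak ja.
  have -> : G a (n0 + a)%N (j0 + a)%N = ((g n0 j0).-1 + a.+1)%N.
    by rewrite /G gv//; clear -b0; lia.
  have -> : G a.+1 (n0 + a)%N (j0 + a)%N = ((g n0 j0).-1 + a)%N.
    by rewrite /G gv//; clear -b0; lia.
  move=> /(_ _)/wrap[p i pk ip ne|e].
    by rewrite /G; clear -ne; lia.
  have la := lambda_gt0 ((g n0 j0).-1 + a)%N.
  apply: (mulIf (lt0r_neq0 la)).
  rewrite mulrAC e mulrAC IH ?(ltnW am)// ?(ltnW ak)//.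
  by rewrite mulrAC.
have -> : (g n0 j0 + m - m.+1)%N = (g n0 j0).-1 by clear; lia.
(* Row k does not enter the weight: a chain that ends there changes m factors and not m + 1, whence
   the predecessor in the statement. *)
case: ltnP => nk'.
  have := GE m.+1 (leqnn _); rewrite addnS => /(_ nk').
  have -> : ((g n0 j0).-1 + m.+1)%N = (g n0 j0 + m)%N by clear -b0; lia.
  move=> <-; congr (_ * _); apply: eq_pattern_weight => p i _ _.
  by rewrite /G; clear; lia.
have := GE m (leqnSn _) nk.
have -> : ((g n0 j0).-1 + m)%N = (g n0 j0 + m).-1 by clear -b0; lia.
move=> <-; congr (_ * _); apply: eq_pattern_weight => p i pk ip.
by rewrite /G; clear -pk nk'; lia.
Qed.

(** Two retractions with the same result lower the same particles, so the end of each chain lies on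
    the other chain: same diagonal, and neither end is above the other. *)
Lemma retract_uniq k z g n j n' j' : interlacing k g ->
  (n <= k)%N -> (j <= n)%N -> (n' <= k)%N -> (j' <= n')%N ->
  can_retract k g n j -> can_retract k g n' j' ->
  agree k z (retract g n j) -> agree k z (retract g n' j') -> n = n' /\ j = j'.
Proof.
move=> gP nk jn nk' jn' v v' /agreeP a /agreeP a'.
have on n1 j1 n2 j2 : (n2 <= k)%N -> (j2 <= n2)%N -> can_retract k g n2 j2 ->
    retract g n1 j1 n2 j2 = retract g n2 j2 n2 j2 -> (n2 <= n1)%N /\ (n2 + j1 =
      j2 + n1)%N.
  move=> nk2 jn2 v2; have [_ d2] := retract_interlacing gP nk2 jn2 v2.
  rewrite /retract leq_subr leqnn [(n2 + j2)%N]addnC eqxx /=.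
  case: (boolP (_ && (n2 + j1 == _)%N)) => [/andP[/andP[_ ?] /eqP ?] //|_].
  have := leq_trans (ltn0Sn _) d2; clear.
  by case: (g n2 j2) => // m _; rewrite subn0 subn1 => /esym/eqP; rewrite /= ltn_eqF.
have [n21 e21] := on n j n' j' nk' jn' v' ltac:(by rewrite -a// -a').
have [n12 _] := on n' j' n j nk jn v ltac:(by rewrite -a'// -a).
have nn : n = n' by apply/eqP; rewrite eqn_leq n12 n21.
by split=> //; apply/eqP; rewrite -(eqn_add2l n') e21 nn addnC.
Qed.

(** Turns a sum over the clocks of z into a sum over the predecessors of g. Each side has at most
    one nonzero term, and the matching term carries the same rate: that of the particle that starts
    the push. *)
Lemma inflow_rate N k z g : interlacing N z -> interlacing k g -> (k <= N)%N ->
  \sum_(n < k.+1) \sum_(j < n.+1) lambda (z n j) *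
    (~~ blocked z n j && agree k (push (N - n) z n j) g)%:R =
  \sum_(n < k.+1) \sum_(j < n.+1)
    (can_retract k g n j)%:R * lambda (g n j - (depth g n j).+1)%N *
    (agree k z (retract g n j))%:R.
Proof.
move=> zP gP kN.
pose FL n j := lambda (z n j) *
  (~~ blocked z n j && agree k (push (N - n) z n j) g)%:R.
pose FR n j := (can_retract k g n j)%:R * lambda (g n j - (depth g n j).+1)%N *
    (agree k z (retract g n j))%:R.
change (\sum_(n < k.+1) \sum_(j < n.+1) FL n j =
  \sum_(n < k.+1) \sum_(j < n.+1) FR n j).
pose Q n j := [/\ (n <= k)%N, (j <= n)%N,
  ~~ blocked z n j & agree k (push (N - n) z n j) g].
have [[n0 [j0 [n0k j0n nb ag]]]|nQ] := pselect (exists n j, Q n j); last first.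
  rewrite (@triangle_sum0 _ _ FL); last first.
    move=> n j nk jn; rewrite /FL; case: andP => [[nb ag]|_]; last by rewrite mulr0.
    by case: nQ; exists n, j; split.
  rewrite (@triangle_sum0 _ _ FR)// => n j nk jn; rewrite /FR.
  case: (boolP (can_retract k g n j)) => [v|_]; last by rewrite !mul0r.
  case: (boolP (agree k z _)) => [a|_]; last by rewrite mulr0.
  have /= [nb ag _] := retract_push zP gP kN nk jn v a.
  by case: nQ; do 2!eexists; split; [| |exact: nb|exact: ag];
     [exact: leq_trans (leq_subr _ _) nk|exact: leq_sub2r].
have [n [j [nk jn v a [n0E j0E zE]]]] := push_retract zP gP kN n0k j0n nb ag.
rewrite (@triangle_sum1 _ _ FL n0 j0)//; last first.
  move=> n1 j1 nk1 jn1; rewrite /FL; case: andP => [[nb1 ag1] _|_];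
    last by rewrite mulr0 eqxx.
  have [n' [j' [nk' jn' v' a' [n1E j1E _]]]] := push_retract zP gP kN nk1 jn1 nb1 ag1.
  have [en ej] := retract_uniq gP nk jn nk' jn' v v' a a'.
  by rewrite n1E j1E -en -ej n0E j0E.
rewrite (@triangle_sum1 _ _ FR n j)//; last first.
  move=> n' j' nk' jn'; rewrite /FR.
  case: (boolP (can_retract k g n' j')) => [v'|_]; last by rewrite !mul0r eqxx.
  case: (boolP (agree k z _)) => [a' _|_]; last by rewrite mulr0 eqxx.
  by have [-> ->] := retract_uniq gP nk jn nk' jn' v v' a a'.
by rewrite /FL /FR nb ag v a !mulr1 mul1r zE.
Qed.

(* A blocked particle sits on the same site as the particle that blocks it, and the
   latter cannot be the last one moved: blocked particles of one level cancel
   particles of the level below that cannot be retracted. *)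
Lemma outflow_rate k g : interlacing k g ->
  \sum_(n < k.+1) \sum_(j < n.+1) (~~ blocked g n j)%:R * lambda (g n j) =
  \sum_(n < k) \sum_(j < n.+1) (g n.+1 j < g n j)%N%:R * lambda (g n j) +
  \sum_(j < k.+1) lambda (g k j).
Proof.
elim: k => [|k IH] gP.
  by rewrite !big_ord1 big_ord0 add0r mul1r.
have gP' : interlacing k g by move=> n j nk; apply: gP; exact: ltnW.
rewrite big_ord_recr /= {}IH// [in RHS]big_ord_recr /=.
rewrite -!addrA; congr (_ + _).
rewrite [X in _ + X = _]big_ord_recr [X in _ = _ + X]big_ord_recr /= !addrA;
  congr (_ + _).
  rewrite -!big_split /=; apply: eq_bigr => j _.
  have jk : (j <= k)%N by rewrite -ltnS.
  have /andP[g1 _] := gP k j (ltnSn _) jk.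
  rewrite /blocked ltnS jk /=.
  move: g1; rewrite leq_eqVlt; case: (eqVneq (g k.+1 j)) => [->|ne /= ->].
    by rewrite ltnn /= !mul0r add0r addr0.
  by rewrite !mul1r addrC.
by rewrite /blocked ltnn mul1r.
Qed.
End Weights.

(** * Karlin-McGregor determinants *)

Section BirthDeterminant.
Variables (R : realType) (lambda : nat -> R) (etL : R -> nat -> nat -> R) (C : R).
Hypothesis lambda_gt0 : forall x, 0 < lambda x.
Hypothesis lambda_le : forall x, lambda x <= C.
Hypothesis etLP : jump_transition_function (pure_birth_rate lambda) etL.
Implicit Types (x y : nat -> nat) (g : nat -> nat -> nat) (k n j : nat) (t : R).

Let etLT : transition_function etL := jump_transition etLP.

Lemma transport_transition s t (a : nat) : 0 <= s -> 0 <= t ->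
  transport etL (etL s a) t = etL (s + t) a.
Proof.
move=> s0 t0; apply/funext => b; apply: EFin_inj.
rewrite (transition_comp etLT)// (wsumE (transition_weight etLT _ _))//.
exact: transition_bounded.
Qed.

Lemma birth_forward (a b : nat) : right_derivative (fun t => etL t a b)
  (fun t => (0 < b)%N%:R * lambda b.-1 * etL t a b.-1 - lambda b * etL t a b).
Proof.
have C0 : 0 <= C by apply: le_trans (lambda_le 0%N); exact: ltW.
(* The birth chain as a jump chain with a single clock, indexed by ['I_1]. *)
have qE : pure_birth_rate lambda =
    fun c e => \sum_(u : 'I_1) lambda c * (c.+1 == e)%:R.
  by apply/funext => c; apply/funext => e; rewrite big_ord1 /pure_birth_rate eq_sym.
have qp := etLP; rewrite qE in qp.
have w0 := transition_weight etLT a (lexx 0).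
have massE t : 0 <= t -> forall e,
  wmass (transport etL (etL 0 a) t) [set e] = etL t a e.
  move=> t0 e; rewrite (wmass_set1 (transport_weight etLT w0 t0)).
  by rewrite transport_transition// add0r.
have := @forward_equation _ _ _ _ (fun c (_ : 'I_1) => lambda c) (fun c _ => c.+1)
  C _ C0 _ qp _ [set b] w0 'I_1 (fun=> (0 < b)%N%:R * lambda b.-1)
  (fun=> [set b.-1]) (lambda b) _ _ _.
move=> /(_ _ _ _ _ _)/rder_ext; apply.
- by move=> c _; exact: ltW.
- by move=> c; rewrite big_ord1.
- by move=> _; rewrite mulr_ge0// ltW.
- exact: ltW.
- move=> c; rewrite !big_ord1 !mem_set1E.
  case: b {massE} => [|b] /=.
    by rewrite !mul0r !sub0r mulrN; case: eqP => [->//|_]; rewrite !mulr0.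
  by rewrite mul1r mulrBr eqSS; congr (_ - _); case: eqP => [->//|_]; rewrite !mulr0.
- by move=> t t0; rewrite massE.
- by move=> t t0; rewrite big_ord1 !massE.
Qed.

Definition birth_det k t x y : R :=
  \det (\matrix_(i < k.+1, j < k.+1) etL t (x i) (y j)).

(** The permutation is put on the starting points, so that factor j carries the endpoint [y j], on
    which the forward equation acts. *)
Lemma birth_detE k t x y : birth_det k t x y =
  \sum_(s : 'S_k.+1) (-1) ^+ s * \prod_(j < k.+1) etL t (x (s j)) (y j).
Proof.
rewrite /birth_det -det_tr; apply: eq_bigr => s _; congr (_ * _).
by apply: eq_bigr => j _; rewrite !mxE.
Qed.

Lemma eq_birth_det k t x y y' : (forall j, (j <= k)%N -> y j = y' j) ->
  birth_det k t x y = birth_det k t x y'.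
Proof.
move=> yy'; congr (\det _); apply/matrixP => i j; rewrite !mxE yy'//.
by rewrite -ltnS.
Qed.

Lemma birth_det_eq0 k t x y i j : (i <= k)%N -> (j <= k)%N -> i <> j -> y i = y j ->
  birth_det k t x y = 0.
Proof.
move=> ik jk ij yij; rewrite /birth_det -det_tr.
apply: (@determinant_alternate _ _ _ (Ordinal (ik : (i < k.+1)%N)) (Ordinal (jk : (j
  < k.+1)%N))).
  by apply/eqP => -[].
by move=> a; rewrite !mxE /= yij.
Qed.

Definition lower y j : nat -> nat := fun i => (y i - (i == j))%N.

(** The forward equation of k + 1 independent birth chains, with no regard for collisions: each
    permutation contributes a product of one-particle solutions. *)
Lemma birth_det_forward k x y : right_derivative (fun t => birth_det k t x y)
  (fun t => \sum_(j < k.+1) ((0 < y j)%N%:R * lambda (y j).-1 * birth_det k t x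
    (lower y j)
     - lambda (y j) * birth_det k t x y)).
Proof.
pose F (s : 'S_k.+1) (j : 'I_k.+1) t := etL t (x (s j)) (y j).
pose F' (s : 'S_k.+1) (j : 'I_k.+1) t := (0 < y j)%N%:R * lambda (y j).-1 * etL t (x
  (s j)) (y j).-1 - lambda (y j) * F s j t.
have := @rder_sum R _ (index_enum _) xpredT
  (fun (s : 'S_k.+1) t => (-1) ^+ s * \prod_(j < k.+1) F s j t) _
  (fun s _ => rderZ ((-1) ^+ s) (rder_prod (fun j : 'I_k.+1 =>
    birth_forward (x (s j)) (y j)))).
move=> /rder_ext; apply=> t t0; first by rewrite birth_detE.
transitivity (\sum_(j < k.+1) \sum_(s : 'S_k.+1) (-1) ^+ s *
    ((0 < y j)%N%:R * lambda (y j).-1 * \prod_(i < k.+1) etL t (x (s i)) (lower y j i)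
     - lambda (y j) * \prod_(i < k.+1) etL t (x (s i)) (y i))).
  rewrite exchange_big /=; apply: eq_bigr => s _; rewrite mulr_sumr.
  apply: eq_bigr => j _; congr (_ * _).
  rewrite (bigD1 j)//= eqxx [X in _ = _ * X - _](bigD1 j)//= [X in _ =
    _ - _ * X](bigD1 j)//=.
  rewrite (eq_bigr (fun i => etL t (x (s i)) (y i))) => [|i ij]; last first.
    by rewrite (negbTE ij).
  rewrite [X in _ = _ * (_ * X) - _](eq_bigr (fun i => etL t (x (s i)) (y i))) =>
    [|i ij]; last first.
    by rewrite /lower (inj_eq val_inj) (negbTE ij) subn0.
  by rewrite /lower eqxx subn1 !mulrA -mulrBl.
apply: eq_bigr => j _; rewrite !birth_detE !mulr_sumr -sumrB.
by apply: eq_bigr => s _; rewrite mulrBr; congr (_ - _); rewrite mulrCA.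
Qed.

Lemma birth_det0 k x y :
  (forall i j, (i < j)%N -> (j <= k)%N -> (x i < x j)%N) ->
  (forall i j, (i < j)%N -> (j <= k)%N -> (y i < y j)%N) ->
  birth_det k 0 x y = [forall i : 'I_k.+1, x i == y i]%:R.
Proof.
move=> xs ys.
have srt z : (forall i j, (i < j)%N -> (j <= k)%N -> (z i < z j)%N) ->
    sorted ltn (map z (iota 0 k.+1)).
  move=> zs; apply/(sortedP 0%N) => i; rewrite size_map size_iota => ik.
  by rewrite !(nth_map 0%N) ?size_iota ?nth_iota ?add0n ?(ltnW ik)//; apply: zs.
case: (boolP [forall i : 'I_k.+1, x i == y i]) => [/forallP xy|/forallP nxy].
  rewrite -[RHS](@det1 R k.+1); congr (\det _); apply/matrixP => i j.
  rewrite !mxE (transition_id etLT) -(eqP (xy j)).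
  congr (nat_of_bool _)%:R; apply/eqP/eqP => [e|->//]; apply: val_inj.
  case: (ltngtP i j) => // ij.
    by have := xs _ _ ij (ltn_ord j); rewrite e ltnn.
  by have := xs _ _ ij (ltn_ord i); rewrite e ltnn.
(* Strictly increasing sequences of equal length coincide as soon as one is contained in the other.
   Otherwise some [x i] is missing from y, and row i vanishes. *)
have [i xi] : exists i : 'I_k.+1, x i \notin map y (iota 0 k.+1).
  apply: contrapT => /forallNP nx; apply: nxy.
  have sub : {subset map x (iota 0 k.+1) <= map y (iota 0 k.+1)}.
    move=> _ /mapP[i + ->]; rewrite mem_iota /= add0n => ik.
    by have /negP := nx (Ordinal ik); rewrite negbK.
  have ux : uniq (map x (iota 0 k.+1)) := sorted_uniq ltn_trans ltnn (srt _ xs).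
  have [_ e] := uniq_min_size ux sub (eq_leq (etrans (size_map _ _) (esym (size_map _
    _)))).
  have := irr_sorted_eq ltn_trans ltnn (srt _ xs) (srt _ ys) e.
  by move=> /eq_in_map H i; rewrite H// mem_iota /= add0n.
rewrite /birth_det (expand_det_row _ i) big1 //= => j _.
rewrite !mxE (transition_id etLT); case: eqP => [e|_]; last by rewrite mul0r.
by move: xi; rewrite e map_f// mem_iota /= add0n.
Qed.

(* A top row that is no longer strictly increasing gives two equal columns. *)
Lemma can_retract_top_birth_det k t x g j : interlacing k g -> (j <= k)%N ->
  (can_retract k g k j)%:R * birth_det k t x (lower (g k) j) =
  (0 < g k j)%N%:R * birth_det k t x (lower (g k) j).
Proof.
move=> gP jk; rewrite /can_retract ltnn; case: ltnP => //= gj; last first.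
have [//|j0] := posnP j; rewrite /=; case: ltnP => //= gj'.
rewrite (@birth_det_eq0 _ _ _ _ j.-1 j) ?mulr0//.
- by rewrite (leq_trans (leq_pred _)).
- by apply/eqP; rewrite neq_ltn prednK ?leqnn.
have := @interlacing_sorted k g k j.-1 j gP (leqnn _).
rewrite prednK// leqnn => /(_ isT jk) gl.
rewrite /lower eqxx (_ : (j.-1 == j) = false); last by clear -j0; lia.
by clear -gl gj'; lia.
Qed.

(** The equation has the coefficients of [push_block_forward]. Terms with n < k cancel the first sum
    of [outflow_rate]; terms with n = k and the second sum give [birth_det_forward]. *)
Lemma birth_det_weight_forward k x g : interlacing k g ->
  right_derivative (fun t => birth_det k t x (g k) * pattern_weight lambda k g)
  (fun t => \sum_(n < k.+1) \sum_(j < n.+1)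
     (can_retract k g n j)%:R * lambda (g n j - (depth g n j).+1)%N *
       (birth_det k t x (retract g n j k) * pattern_weight lambda k (retract g n j)) -
     (\sum_(n < k.+1) \sum_(j < n.+1) (~~ blocked g n j)%:R * lambda (g n j)) *
       (birth_det k t x (g k) * pattern_weight lambda k g)).
Proof.
move=> gP; have := rderM (birth_det_forward k x (g k)) (rder_cst (pattern_weight
  lambda k g)).
move=> /rder_ext; apply=> // t t0; rewrite mulr0 addr0.
pose T := fun n j : nat => (can_retract k g n j)%:R * lambda (g n j - (depth g n
  j).+1)%N *
  (birth_det k t x (retract g n j k) * pattern_weight lambda k (retract g n j)).
have TE n j : (n <= k)%N -> (j <= n)%N -> T n j = (can_retract k g n j)%:R *
    lambda (if (n < k)%N then g n j else (g n j).-1) *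
    birth_det k t x (retract g n j k) * pattern_weight lambda k g.
  move=> nk jn; rewrite /T; case: (boolP (can_retract k g n j)) => [v|_];
    last by rewrite !mul0r.
  have := pattern_weight_retract lambda_gt0 gP nk jn v.
  rewrite !mul1r [birth_det _ _ _ _ * pattern_weight _ _ (retract _ _ _)]mulrC mulrA.
  by rewrite [lambda _ * pattern_weight _ _ _]mulrC => ->; rewrite -mulrA mulrC.
(* A chain that ends below level k leaves row k, hence the determinant, unchanged. *)
have low n j : (n < k)%N -> (j <= n)%N -> T n j =
    (g n.+1 j < g n j)%N%:R * lambda (g n j) * (birth_det k t x (g k) *
      pattern_weight lambda k g).
  move=> nk jn; rewrite TE ?(ltnW nk)// /can_retract nk mulrA; congr (_ * _ * _).
  by apply: eq_birth_det => i ik; rewrite /retract; clear -nk; lia.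
(* In row k only particle j moves back, and the exclusion test can be relaxed to positivity without
   changing the term. *)
have top j : (j <= k)%N -> T k j =
    (0 < g k j)%N%:R * lambda (g k j).-1 * birth_det k t x (lower (g k) j) *
    pattern_weight lambda k g.
  move=> jk; rewrite TE// ltnn; congr (_ * _).
  rewrite (@eq_birth_det _ _ _ (retract g k j k) (lower (g k) j)); last first.
    by move=> i ik; rewrite /retract /lower; clear; lia.
  by rewrite mulrAC can_retract_top_birth_det// mulrAC.
rewrite outflow_rate// -[X in _ = X - _]/(\sum_(n < k.+1) \sum_(j < n.+1) T n j).
have -> : \sum_(n < k.+1) \sum_(j < n.+1) T n j =
    \sum_(n < k) \sum_(j < n.+1) T n j + \sum_(j < k.+1) T k j by rewrite big_ord_recr.
have -> : \sum_(n < k) \sum_(j < n.+1) T n j =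
    (\sum_(n < k) \sum_(j < n.+1) (g n.+1 j < g n j)%N%:R * lambda (g n j)) *
    (birth_det k t x (g k) * pattern_weight lambda k g).
  rewrite mulr_suml; apply: eq_bigr => n _; rewrite mulr_suml; apply: eq_bigr => j _.
  by rewrite low// -ltnS.
have -> : \sum_(j < k.+1) T k j = (\sum_(j < k.+1)
    (0 < g k j)%N%:R * lambda (g k j).-1 * birth_det k t x (lower (g k) j)) *
      pattern_weight lambda k g.
  by rewrite mulr_suml; apply: eq_bigr => j _; rewrite top// -ltnS.
by rewrite sumrB -mulr_suml mulrBl [in RHS]mulrDl -!mulrA opprD addrACA subrr add0r.
Qed.
End BirthDeterminant.

Lemma triangle_ltn k (f g : nat -> nat -> nat) n0 j0 : (n0 <= k)%N -> (j0 <= n0)%N ->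
  (forall n j, (n <= k)%N -> (j <= n)%N -> (f n j <= g n j)%N) ->
  (f n0 j0 < g n0 j0)%N ->
  (\sum_(n < k.+1) \sum_(j < n.+1) f n j < \sum_(n < k.+1) \sum_(j < n.+1) g n j)%N.
Proof.
move=> n0k j0n fg fg0; have n0k' : (n0 < k.+1)%N by [].
have j0n' : (j0 < (Ordinal n0k').+1)%N by [].
have le n j : (n < k.+1)%N -> (j < n.+1)%N -> (f n j <= g n j)%N by move=> *; exact: fg.
rewrite (bigD1 (Ordinal n0k'))//= [X in (_ < X)%N](bigD1 (Ordinal n0k'))//=.
rewrite -addSn leq_add//; last first.
  by apply: leq_sum => n _; apply: leq_sum => j _; exact: le.
rewrite (bigD1 (Ordinal j0n'))//= [X in (_ < X)%N](bigD1 (Ordinal j0n'))//=.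
by rewrite -addSn leq_add//; apply: leq_sum => j _; exact: le.
Qed.

Lemma triangle_sig (R : nmodType) k (F : nat -> nat -> R) :
  \sum_(a : {n : 'I_k.+1 & 'I_n.+1}) F (tag a) (tagged a) =
  \sum_(n < k.+1) \sum_(j < n.+1) F n j.
Proof.
exact: esym (sig_big_dep xpredT (fun=> xpredT) (fun (n : 'I_k.+1) (j : 'I_n.+1) =>
  F n j)).
Qed.

(** * Forward equations of the push-block dynamics *)

Section Patterns.
Variable N : nat.
Implicit Types (x y : GT N.+1) (n j k : nat).

Lemma coordsE x (n : 'I_N.+1) j : coords x n j = nth 0%N (level x n) j.
Proof. by rewrite /coords valK. Qed.

Lemma coords_interlacing x : interlacing N (coords x).
Proof.
move=> n j nN jn; case: x => x xP.
have nN' : (n < N.+1)%N by rewrite ltnW.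
have nN1 : (n.+1 < N.+1)%N by [].
have /forallP/(_ (Ordinal nN'))/forallP/(_ (Ordinal nN1)) /= := xP.
rewrite eqxx /= => /allP/(_ j).
rewrite size_tuple mem_iota /= add0n ltnS jn => /(_ isT).
by rewrite !(coordsE (MkGT xP) (Ordinal nN1)) (coordsE (MkGT xP) (Ordinal nN')).
Qed.

Lemma level_eqP x (n : 'I_N.+1) (y : W n.+1) :
  (level x n = y) <-> (forall j, (j <= n)%N -> coords x n j = nth 0%N y j).
Proof.
split=> [<- j _|xy]; first by rewrite coordsE.
apply/val_inj/val_inj/(@eq_from_nth _ 0%N) => [|j]; first by rewrite !size_tuple.
by rewrite size_tuple ltnS => jn; rewrite -coordsE xy.
Qed.

Lemma agree_inj x y : agree N (coords x) (coords y) -> x = y.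
Proof.
move=> /agreeP xy; apply/val_inj/ffunP => n; apply: (level_eqP x (level y n)).2 => j jn.
by rewrite -coordsE; apply: xy => //; rewrite -ltnS.
Qed.

Definition particle := {n : 'I_N.+1 & 'I_n.+1}.

Definition ring_move x (a : particle) : GT N.+1 :=
  sval (cid (ring_leads_toP x (tagged a))).

Lemma ring_leads_toE x (a : particle) y :
  ring_leads_to x (tag a) (tagged a) y = (ring_move x a == y).
Proof.
rewrite /ring_move; case: cid => /= z [xz zu].
by apply/idP/eqP => [/zu//|<-].
Qed.

Lemma coords_ring_move x (a : particle) n j : (n <= N)%N -> (j <= n)%N ->
  coords (ring_move x a) n j = ring_clock N.+1 (coords x) (tag a) (tagged a) n j.
Proof.
move=> nN jn; have := ring_leads_toE x a (ring_move x a); rewrite eqxx.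
move=> /forallP/(_ (Ordinal (nN : (n < N.+1)%N))).
by move=> /forallP/(_ (Ordinal (jn : (j < n.+1)%N)))/eqP.
Qed.

Definition bottom_levels k (g : nat -> nat -> nat) : set (GT N.+1) :=
  [set x | agree k (coords x) g].

Lemma mem_bottom_levels k g x : (x \in bottom_levels k g) = agree k (coords x) g.
Proof. by apply/idP/idP => [/set_mem|xg]; [|exact/mem_set]. Qed.

Lemma push_above a c n j m i : (m < n)%N -> push a c n j m i = c m i.
Proof.
move=> mn; have [l [_ -> _ _]] := push_spec a c n j.
by rewrite leqNgt mn addn0.
Qed.

(** A push never moves a particle below the level of the clock that rang, so clocks above level k do
    not affect the event. *)
Lemma ring_move_bottom_levels k g x (a : particle) : (k <= N)%N ->
  (ring_move x a \in bottom_levels k g) =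
  if (tag a <= k)%N && ~~ blocked (coords x) (tag a) (tagged a)
  then agree k (push (N - tag a) (coords x) (tag a) (tagged a)) g
  else agree k (coords x) g.
Proof.
move=> kN; rewrite mem_bottom_levels.
have -> : agree k (coords (ring_move x a)) g =
    agree k (ring_clock N.+1 (coords x) (tag a) (tagged a)) g.
  by apply/agreeP/agreeP => H n j nk jn; rewrite -H// coords_ring_move// (leq_trans nk).
rewrite /ring_clock subSS; case: blocked; first by rewrite andbF.
rewrite andbT; case: leqP => // ak.
by apply/agreeP/agreeP => H n j nk jn; rewrite -H// push_above// (leq_ltn_trans nk).
Qed.

Variables (R : realType) (lambda : nat -> R).
Hypothesis lambda_gt0 : forall i : nat, 0 < lambda i.

(** Supplies [generator_indic]. The gains are rewritten by [inflow_rate]; the loss depends on g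
    alone, because whether a ring at level at most k is blocked can be read off those levels. *)
Lemma push_block_generator k g x : (k <= N)%N -> interlacing k g ->
  \sum_(a : particle) lambda (coords x (tag a) (tagged a)) *
    ((ring_move x a \in bottom_levels k g)%:R - (x \in bottom_levels k g)%:R) =
  \sum_(b : {n : 'I_k.+1 & 'I_n.+1})
    (can_retract k g (tag b) (tagged b))%:R *
    lambda (g (tag b) (tagged b) - (depth g (tag b) (tagged b)).+1)%N *
    (x \in bottom_levels k (retract g (tag b) (tagged b)))%:R -
  (\sum_(n < k.+1) \sum_(j < n.+1) (~~ blocked g n j)%:R * lambda (g n j)) *
    (x \in bottom_levels k g)%:R.
Proof.
move=> kN gP.
under eq_bigr do rewrite ring_move_bottom_levels// mem_bottom_levels.
under [X in _ = X - _]eq_bigr do rewrite mem_bottom_levels.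
rewrite mem_bottom_levels.
pose F n j := lambda (coords x n j) * (((if (n <= k)%N && ~~ blocked (coords x) n j
  then agree k (push (N - n) (coords x) n j) g
  else agree k (coords x) g))%:R - (agree k (coords x) g)%:R).
pose G n j := (can_retract k g n j)%:R * lambda (g n j - (depth g n j).+1)%N *
  (agree k (coords x) (retract g n j))%:R.
transitivity (\sum_(a : particle) F (tag a) (tagged a)) => //.
rewrite (triangle_sig N F) -[X in _ =
  X - _]/(\sum_(a : {n : 'I_k.+1 & 'I_n.+1}) G (tag a) (tagged a)).
rewrite (triangle_sig k G).
rewrite -(inflow_rate lambda (coords_interlacing x))//.
have -> : \sum_(n < N.+1) \sum_(j < n.+1) F n j = \sum_(n < k.+1) \sum_(j < n.+1) F n j.
  rewrite [RHS](big_ord_widen N.+1 (fun n => \sum_(j < n.+1) F n j))//.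
  rewrite [RHS]big_mkcond /=; apply: eq_bigr => n _; case: ifPn => // nk.
  by rewrite big1// => j _; rewrite /F -ltnS (negbTE nk) /= subrr mulr0.
rewrite mulr_suml -sumrB; apply: eq_bigr => n _; rewrite mulr_suml -sumrB.
apply: eq_bigr => j _; rewrite /F; have nk : (n <= k)%N by rewrite -ltnS.
have jn : (j <= n)%N by rewrite -ltnS.
rewrite nk /=; case: (boolP (agree k (coords x) g)) => [/agreeP ag|_].
  have -> : blocked g n j = blocked (coords x) n j.
    rewrite /blocked; case: ltnP => //= jn'.
    rewrite (ag n j nk jn) (ag n.-1 j)//; first by rewrite (leq_trans (leq_pred _)).
    by clear -jn'; lia.
  rewrite ag//; case: blocked => /=; first by rewrite !subrr !mulr0 !mul0r subr0.
  by rewrite mulrBr mul1r.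
by rewrite mulr0 !subr0; case: blocked.
Qed.

Variables (etL : R -> nat -> nat -> R) (C : R) (p : R -> GT N.+1 -> GT N.+1 -> R).
Hypothesis lambda_le : forall i, lambda i <= C.
Hypothesis etLP : jump_transition_function (pure_birth_rate lambda) etL.
Hypothesis pP : jump_transition_function (@push_block_rate R lambda N.+1) p.

Lemma push_block_forward k g (U : GT N.+1 -> R) : (k <= N)%N -> interlacing k g ->
  summable_weight U ->
  right_derivative (fun t => wmass (transport p U t) (bottom_levels k g))
  (fun t => \sum_(n < k.+1) \sum_(j < n.+1)
     (can_retract k g n j)%:R * lambda (g n j - (depth g n j).+1)%N *
       wmass (transport p U t) (bottom_levels k (retract g n j)) -
     (\sum_(n < k.+1) \sum_(j < n.+1) (~~ blocked g n j)%:R * lambda (g n j)) *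
       wmass (transport p U t) (bottom_levels k g)).
Proof.
move=> kN gP UP.
have C0 : 0 <= C by apply: le_trans (lambda_le 0%N); exact: ltW.
have qE : @push_block_rate R lambda N.+1 =
    fun x y => \sum_(a : particle) lambda (coords x (tag a) (tagged a)) * (ring_move
      x a == y)%:R.
  apply/funext => x; apply/funext => y; rewrite /push_block_rate.
  rewrite (sig_big_dep xpredT (fun=> xpredT) (fun (n : 'I_N.+1) (j : 'I_n.+1) =>
    lambda (coords x n j) * (ring_leads_to x n j y)%:R)).
  by apply: eq_bigr => a _; rewrite ring_leads_toE.
have qp := pP; rewrite qE in qp.
pose F n j t := (can_retract k g n j)%:R * lambda (g n j - (depth g n j).+1)%N *
       wmass (transport p U t) (bottom_levels k (retract g n j)).
have := @forward_equation _ _ _ _ (fun x (a : particle) =>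
  lambda (coords x (tag a) (tagged a)))
  ring_move (#|{: particle}|%:R * C) _ _ _ qp U (bottom_levels k g) UP
  {n : 'I_k.+1 & 'I_n.+1}
  (fun b => (can_retract k g (tag b) (tagged b))%:R *
    lambda (g (tag b) (tagged b) - (depth g (tag b) (tagged b)).+1)%N)
  (fun b => bottom_levels k (retract g (tag b) (tagged b)))
  (\sum_(n < k.+1) \sum_(j < n.+1) (~~ blocked g n j)%:R * lambda (g n j)) _ _ _.
move=> /(_ _ _ _ _ _ _)/rder_ext; apply.
- by move=> x a; exact: ltW.
- by rewrite mulr_ge0.
- move=> x; rewrite mulr_natl -sumr_const; apply: ler_sum => a _; exact: lambda_le.
- by move=> b; rewrite mulr_ge0// ltW.
- by apply: sumr_ge0 => n _; apply: sumr_ge0 => j _; rewrite mulr_ge0// ltW.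
- by move=> x; exact: push_block_generator.
- by [].
- by move=> t _; congr (_ - _); rewrite -(triangle_sig k (fun n j => F n j t)).
Qed.

(* [retract] decreases the sum of the coordinates, so that the forward equations
   can be solved one pattern at a time, by induction on this sum. *)
Theorem bottom_levels_evolution k (x : nat -> nat) (r : R) (U : GT N.+1 -> R) :
  (k <= N)%N -> (forall i j, (i < j)%N -> (j <= k)%N -> (x i < x j)%N) ->
  summable_weight U ->
  (forall g, interlacing k g -> wmass U (bottom_levels k g) =
     [forall i : 'I_k.+1, x i == g k i]%:R * pattern_weight lambda k g * r) ->
  forall t g, 0 <= t -> interlacing k g ->
  wmass (transport p U t) (bottom_levels k g) =
  birth_det etL k t x (g k) * pattern_weight lambda k g * r.
Proof.
move=> kN xs UP U0 t g t0; move: t t0;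
  pose size g := (\sum_(n < k.+1) \sum_(j < n.+1) g n j)%N.
have [s] := ubnP (size g); elim: s g => // s IH g gs t t0 gP.
pose f t := wmass (transport p U t) (bottom_levels k g).
pose v t := birth_det etL k t x (g k) * pattern_weight lambda k g * r.
suff : f t + -1 * v t = 0 by move/eqP; rewrite mulN1r subr_eq0 => /eqP.
pose c := \sum_(n < k.+1) \sum_(j < n.+1) (~~ blocked g n j)%:R * lambda (g n j).
have c0 : 0 <= c by apply: sumr_ge0 => n _; apply: sumr_ge0 => j _;
  rewrite mulr_ge0// ltW.
apply: (@rder_linear_eq0 _ (fun t => f t + -1 * v t) c) t0 => //; last first.
  rewrite /f /v transport0//; last exact: jump_transition pP.
  rewrite U0// (birth_det0 etLP xs) ?mulN1r ?subrr// => i j ij jk.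
  exact: interlacing_sorted gP (leqnn _) ij jk.
have fd := push_block_forward kN gP UP.
have vd := rderM (birth_det_weight_forward lambda_gt0 lambda_le etLP x gP) (rder_cst r).
apply: rder_ext (rderD fd (rderZ (-1) vd)) _ _ => // u u0.
rewrite -/c -/(f u) mulr0 addr0 mulrBl -[c * _ * r]mulrA -/(v u).
set A := \sum_(n < k.+1) _; set B := \sum_(n < k.+1) _.
(* The inflow terms of f and of v agree by induction, so f - v solves the equation of
   [rder_linear_eq0]. *)
have -> : A = B * r; last first.
  by move: (B * r) (c) (f u) (v u) => a1 a2 a3 a4; ring.
rewrite /A /B mulr_suml; apply: eq_bigr => n _; rewrite mulr_suml;
  apply: eq_bigr => j _.
have nk : (n <= k)%N by rewrite -ltnS.
have jn : (j <= n)%N by rewrite -ltnS.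
case: (boolP (can_retract k g n j)) => [vv|_]; last by rewrite !mul0r.
have [preP dg] := retract_interlacing gP nk jn vv.
rewrite ltnS in gs; rewrite IH// ?mulrA//; apply: leq_trans gs.
apply: (@triangle_ltn k (retract g n j) g n j) => // [n' j' _ _|];
  first exact: leq_subr.
by rewrite /retract; clear -dg; lia.
Qed.
End Patterns.

(** * Gibbs measures *)

Section Fibers.
Variable R : realType.
Implicit Types S T : choiceType.

Lemma esum_fiber S T (L : S -> T) (a : S -> \bar R) : (forall x, 0 <= a x)%E ->
  (\esum_(x in [set: S]) a x =
   \esum_(y in [set: T]) \esum_(x in L @^-1` [set y]) a x)%E.
Proof.
move=> a0; rewrite esum_esum//.
rewrite (reindex_esum [set: S] _ (fun x => (L x, x)))//; split=> //=.
- by move=> x y _ _ [].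
- by move=> [y x] [_ /= Lx]; exists x => //; rewrite Lx.
Qed.

Definition restrict_weight S (V : S -> R) (A : set S) : S -> R :=
  fun x => V x * (x \in A)%:R.

Lemma restrict_summable S (V : S -> R) A :
  summable_weight V -> summable_weight (restrict_weight V A).
Proof.
move=> [V0 Vfin]; split=> [x|]; first by rewrite mulr_ge0.
apply: le_lt_trans Vfin; apply: le_esum => x _.
by rewrite lee_fin ler_piMr// lern1 leq_b1.
Qed.

Lemma wmass_restrict S (V : S -> R) A B :
  wmass (restrict_weight V A) B = wmass V (A `&` B).
Proof.
congr fine; apply: eq_esum => x _; rewrite /restrict_weight in_setI -mulrA.
by rewrite -natrM mulnb.
Qed.

Lemma wmass_fiber S T (L : S -> T) (V : S -> R) A : summable_weight V ->
  ((wmass V A)%:E = \esum_(y in [set: T]) (wmass V (A `&` L @^-1` [set y]))%:E)%E.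
Proof.
move=> VP; have [V0 _] := VP.
have VA := restrict_summable A VP.
transitivity ((wmass (restrict_weight V A) [set: S])%:E)%E.
  by rewrite wmass_restrict setIT.
rewrite wmassE// (esum_fiber L); last by move=> x; rewrite lee_fin; case: VA.
by apply: eq_esum => y _; rewrite -wmassE// wmass_restrict.
Qed.

Lemma wmass_eq0 S (V : S -> R) (A : set S) : (forall x, ~ A x) -> wmass V A = 0.
Proof. by move=> A0; rewrite (_ : A = set0) ?wmass_set0//; apply/seteqP; split. Qed.

Lemma esum_finite T (D : set T) (f : T -> R) : finite_set D ->
  (forall y, 0 <= f y) -> (forall y, ~ D y -> f y = 0) ->
  (\esum_(y in [set: T]) (f y)%:E = (\sum_(y \in D) f y)%:E)%E.
Proof.
move=> Dfin f0 fD; rewrite (esumID D) => [|y _]; last by rewrite lee_fin.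
rewrite !setTI [X in (_ + X)%E]esum1 ?adde0 => [|y Dy]; last by rewrite fD.
rewrite esum_fset// => [|y _]; last by rewrite lee_fin.
by rewrite !fsbig_finite//= sumEFin.
Qed.
End Fibers.

(** * Interlacing rows and patterns built from arrays *)

Section InterlacingRows.
Local Open Scope nat_scope.

Lemma W_sorted k (y : W k) i j : i < j -> j < k -> nth 0 y i < nth 0 y j.
Proof.
move=> ij jk; case: y => y ys /=; apply: (sorted_ltn_nth ltn_trans 0 ys) => //.
  by rewrite inE size_tuple (ltn_trans ij).
by rewrite inE size_tuple.
Qed.

Lemma W_of_fun k (f : nat -> nat) : (forall i j, i < j -> j < k -> f i < f j) ->
  exists y : W k, forall i, i < k -> nth 0 y i = f i.
Proof.
move=> fs; pose t := [tuple f (val i) | i < k].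
have tE i : i < k -> nth 0 t i = f i.
  by move=> ik; rewrite -(tnth_nth 0 _ (Ordinal ik)) tnth_mktuple.
have ts : sorted ltn t.
  apply/(sortedP 0) => i; rewrite size_tuple => ik.
  by rewrite (tE i (ltnW ik)) (tE _ ik); exact: fs.
by exists (MkW ts).
Qed.

Lemma interlacesP k m (y : W k) (x : W m) :
  reflect (forall i, i < k -> nth 0 x i <= nth 0 y i < nth 0 x i.+1) (interlaces y x).
Proof.
apply: (iffP allP) => H i.
  by move=> ik; apply: H; rewrite mem_iota size_tuple.
by rewrite mem_iota size_tuple /= add0n; exact: H.
Qed.

Lemma finite_interlaces k (x : W k.+1) : finite_set [set y : W k | interlaces y x].
Proof.
pose b := (nth 0 x k).+1.
pose f (h : {ffun 'I_k -> 'I_b}) : seq nat := [seq val (h i) | i <- enum 'I_k].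
apply: (@sub_finite_set _ _ ((fun y : W k => val (val y)) @^-1` (f @` setT)));
  last first.
  apply: finite_preimage; last exact/finite_image/finite_finset.
  by move=> y y' _ _ e; apply/val_inj/val_inj.
move=> y /interlacesP yx; have yb i : i < k -> nth 0 y i < b.
  move=> ik; have /andP[_ yi] := yx i ik; rewrite ltnS ltnW// (leq_trans yi)//.
  have [->//|ne] := eqVneq i.+1 k.
  by apply/ltnW; apply: W_sorted; rewrite // ltn_neqAle ne.
exists [ffun i : 'I_k => inord (nth 0 y i)] => //.
apply: (@eq_from_nth _ 0) => [|i]; first by rewrite size_map size_enum_ord size_tuple.
rewrite size_map size_enum_ord => ik.
rewrite (nth_map (Ordinal ik)) ?size_enum_ord// ffunE /= inordK.
  by rewrite nth_enum_ord.
by rewrite nth_enum_ord// yb.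
Qed.

Lemma GT_of_array N c : interlacing N c -> exists x : GT N.+1, agree N (coords x) c.
Proof.
move=> cP.
have rowE (n : 'I_N.+1) : exists y : W n.+1, forall i, i < n.+1 -> nth 0 y i = c n i.
  apply: W_of_fun => i j ij jn; apply: (interlacing_sorted cP) => //.
  by rewrite -ltnS.
pose l : {dffun forall n : 'I_N.+1, W n.+1} := [ffun n => sval (cid (rowE n))].
have lE (n : 'I_N.+1) i : i < n.+1 -> nth 0 (l n) i = c n i.
  by rewrite ffunE; case: cid => y /= yE; exact: yE.
have lP : [forall n : 'I_N.+1, forall m : 'I_N.+1,
         (m == n.+1 :> nat) ==> interlaces (l n) (l m)].
  apply/forallP => n; apply/forallP => m; apply/implyP => /eqP mn.
  apply/interlacesP => i im; rewrite !lE ?mn//; last exact: ltnW.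
  by apply: cP; [rewrite -ltnS -mn|rewrite -ltnS].
exists (MkGT lP); apply/agreeP => n j nN jn.
by rewrite (coordsE _ (Ordinal (nN : n < N.+1))) /level /= lE.
Qed.
End InterlacingRows.

Section HFunctions.
Variables (R : realType) (lambda : nat -> R).
Hypothesis lambda_gt0 : forall i : nat, 0 < lambda i.

Definition row_weight k (y : nat -> nat) : R := \prod_(i < k) (lambda (y i))^-1.

Lemma row_weight_gt0 k y : 0 < row_weight k y.
Proof. by apply: prodr_gt0 => i _; rewrite invr_gt0. Qed.

Lemma hfunS k (x : W k.+2) : hfun lambda x =
  \sum_(y \in [set y : W k.+1 | interlaces y x]) (row_weight k.+1 (nth 0%N y) * hfun
    lambda y).
Proof. by []. Qed.

Lemma hfun_gt0 k (x : W k.+1) : 0 < hfun lambda x.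
Proof.
elim: k x => [|k IH] x; first exact: ltr01.
(* x without its last entry interlaces with x, so the sum has a positive term. *)
have [y yE] : exists y : W k.+1, forall i, (i < k.+1)%N -> nth 0%N y i = nth 0%N x i.
  by apply: W_of_fun => i j ij jk; apply: W_sorted => //; exact: ltnW.
have yx : [set y : W k.+1 | interlaces y x] y.
  apply/interlacesP => i ik; rewrite yE// leqnn /=.
  by apply: W_sorted.
rewrite hfunS (fsbigD1 y)//=; last exact: finite_interlaces.
rewrite ltr_wpDr//; last by rewrite mulr_gt0 ?row_weight_gt0 ?IH.
rewrite fsbig_finite/=; last exact/finite_setD/finite_interlaces.
by apply: sumr_ge0 => z _; apply: mulr_ge0; rewrite ltW ?row_weight_gt0 ?IH.
Qed.

Definition set_row (g : nat -> nat -> nat) k (y : nat -> nat) : nat -> nat -> nat :=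
  fun n j => if n == k then y j else g n j.

Lemma interlacing_set_row k g y :
  interlacing k g -> (forall j, (j <= k)%N -> (y j <= g k j < y j.+1)%N) ->
  interlacing k.+1 (set_row g k.+1 y).
Proof.
move=> gP yP n j; rewrite ltnS leq_eqVlt /set_row => /predU1P[->|nk] jn.
  by rewrite eqxx (ltn_eqF (ltnSn k)); exact: yP.
by rewrite eqSS !ltn_eqF// ?gP// ltnW.
Qed.

Lemma pattern_weightS k g :
  pattern_weight lambda k.+1 g = pattern_weight lambda k g * row_weight k.+1 (g k).
Proof. by rewrite /pattern_weight big_ord_recr. Qed.

Lemma pattern_weight_set_row k g y :
  pattern_weight lambda k.+1 (set_row g k.+1 y) = pattern_weight lambda k.+1 g.
Proof.
by apply: eq_pattern_weight => n j nk _; rewrite /set_row ltn_eqF.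
Qed.

Lemma bottom_levelsS N k g (y : nat -> nat) (kN : (k < N)%N) (z : W k.+2) :
  (forall j, (j <= k.+1)%N -> nth 0%N z j = y j) ->
  bottom_levels k.+1 (set_row g k.+1 y) =
  bottom_levels k g `&` [set x : GT N.+1 | level x (Ordinal (kN : (k.+1 < N.+1)%N)) =
    z].
Proof.
move=> zy; apply/seteqP; split=> [x /agreeP xg|x [/agreeP xg /level_eqP xz]].
  split; last by apply/level_eqP => j jk; rewrite xg// /set_row eqxx zy.
  apply/agreeP => n j nk jn; rewrite xg// ?leqW// /set_row ltn_eqF//.
apply/agreeP => n j; rewrite /set_row leq_eqVlt => /predU1P[->|nk] jn.
  by rewrite eqxx -zy// -xz.
by rewrite ltn_eqF// xg.
Qed.

(** [hfun] is a partition function: the total weight of the patterns with top row y. The recursion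
    that defines it splits these patterns by their row just below the top. *)
Lemma hfun_mass N k (kN : (k < N.+1)%N) (V : GT N.+1 -> R) (r : R) (y : W k.+1) :
  summable_weight V ->
  (forall g, interlacing k g -> (forall j, (j <= k)%N -> g k j = nth 0%N y j) ->
     wmass V (bottom_levels k g) = pattern_weight lambda k g * r) ->
  wmass V [set x | level x (Ordinal kN) = y] = hfun lambda y * r.
Proof.
elim: k kN V r y => [|k IH] kN V r y VP Vr.
  have -> : hfun lambda y = 1 by [].
  have := Vr (fun _ => nth 0%N y); rewrite /pattern_weight big_ord0 => <-//.
  congr wmass; apply/seteqP; split => x.
    by move=> /level_eqP xy; apply/agreeP => -[|n]//= j _ jn; rewrite xy.
  by move=> /agreeP xy; apply/level_eqP => j jn; rewrite xy.
have kN' := ltnW kN.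
pose A := [set x : GT N.+1 | level x (Ordinal kN) = y].
(* The condition on the upper row is absorbed into the measure; the induction hypothesis then
   applies one level lower, with r multiplied by the weight of that lower row. *)
pose V' := restrict_weight V A.
have V'P : summable_weight V' := restrict_summable A VP.
apply: EFin_inj; rewrite (wmass_fiber (fun x => level x (Ordinal kN')))//.
rewrite (@esum_finite _ _ [set y' : W k.+1 | interlaces y' y]); last 3 first.
- exact: finite_interlaces.
- by move=> z; apply: wsum_ge0.
- move=> z zy; apply: wmass_eq0 => x [/level_eqP xy /level_eqP xz]; apply: zy.
  apply/interlacesP => i ik; rewrite -(xy i (ltnW ik)) -(xy i.+1 ik) -(xz i ik).
  exact: coords_interlacing.
congr EFin; rewrite hfunS.
rewrite !fsbig_finite/=; [|exact: finite_interlaces..].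
rewrite mulr_suml; apply: finmap.eq_fbigr => z; rewrite in_fset_set;
  last exact: finite_interlaces.
move=> /set_mem/interlacesP zy _.
rewrite -wmass_restrict -/V' (IH kN' V' (row_weight k.+1 (nth 0%N z) * r))//.
  by rewrite mulrA [hfun _ _ * _]mulrC.
move=> g gP gz; rewrite wmass_restrict setIC.
rewrite -(@bottom_levelsS N k g (nth 0%N y) kN y)// Vr.
- rewrite pattern_weight_set_row pattern_weightS mulrA; congr (_ * _ * _).
  by apply: eq_bigr => i _; rewrite gz// -ltnS.
- by apply: interlacing_set_row => // j jk; rewrite gz//; apply: zy.
- by move=> j jk; rewrite /set_row eqxx.
Qed.
End HFunctions.

Lemma wmass_restrict_level (R : realType) N (U : GT N.+1 -> R) k (kN : (k < N.+1)%N)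
  (y : W k.+1) g :
  wmass (restrict_weight U [set x | level x (Ordinal kN) = y]) (bottom_levels k g) =
  [forall i : 'I_k.+1, nth 0%N y i == g k i]%:R * wmass U (bottom_levels k g).
Proof.
rewrite wmass_restrict; case: (boolP [forall i : 'I_k.+1, _]) => [/forallP yg|yg].
  rewrite mul1r; congr wmass; apply/seteqP; split=> [x []//|x xg]; split=> //.
  apply/level_eqP => j jk; move/agreeP : xg => -> //.
  by have /eqP := yg (Ordinal (jk : (j < k.+1)%N)).
rewrite mul0r wmass_eq0// => x [/level_eqP xy /agreeP xg]; move/negP: yg; apply.
apply/forallP => i; have ik : (i <= k)%N by rewrite -ltnS.
by rewrite -(xy i ik) xg.
Qed.

Section GibbsMeasures.
Variables (R : realType) (lambda : nat -> R) (N : nat).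
Hypothesis lambda_gt0 : forall i : nat, 0 < lambda i.
Implicit Types (x : GT N.+1) (k : nat) (g : nat -> nat -> nat).

Lemma telescope_prod_div (f : nat -> R) n : (forall i, f i != 0) ->
  \prod_(i < n) (f i / f i.+1) = f 0%N / f n.
Proof.
move=> f0; elim: n => [|n IH]; first by rewrite big_ord0 divff.
by rewrite big_ord_recr /= IH mulrA divfK.
Qed.

Lemma gibbsE (m : W N.+1 -> \bar R) x :
  gibbs lambda m x = (m (level x ord_max) *
    (pattern_weight lambda N (coords x) / hfun lambda (level x ord_max))%:E)%E.
Proof.
rewrite /gibbs; congr (_ * EFin _)%E.
(* Extended by 1 to all indices, so that it vanishes nowhere and the quotients telescope. *)
pose H i : R := if insub i is Some n then hfun lambda (level x n) else 1.
have HE (n : 'I_N.+1) : H n = hfun lambda (level x n) by rewrite /H valK.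
have H0 i : H i != 0.
  by rewrite /H; case: insub => [n|]; rewrite ?oner_neq0// gt_eqF// hfun_gt0.
transitivity (\prod_(i < N) (H i / H i.+1 * row_weight lambda i.+1 (coords x i))).
  apply: eq_bigr => i _; rewrite /Lkernel -(HE (widen_ord (leqnSn N) i)) -(HE (lift
    ord0 i)).
  have -> : interlaces (level x (widen_ord (leqnSn N) i)) (level x (lift ord0 i)).
    apply/interlacesP => j ji; rewrite -!coordsE.
    exact: coords_interlacing.
  rewrite mulr1; congr (_ * _); apply: eq_bigr => j _.
  by rewrite -(coordsE x (widen_ord (leqnSn N) i)).
rewrite big_split /= telescope_prod_div// mulrC; congr (_ * _).
rewrite (HE ord_max) (_ : H 0%N = 1) ?mul1r//.
by have -> : H 0%N = hfun lambda (level x ord0) by rewrite -HE.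
Qed.

Variables (M : W N.+1 -> R) (U : GT N.+1 -> R).
Hypothesis UP : summable_weight U.
Hypothesis UE : forall x, U x = M (level x ord_max) *
  (pattern_weight lambda N (coords x) / hfun lambda (level x ord_max)).

Lemma wmass_pattern x : wmass U (bottom_levels N (coords x)) = U x.
Proof.
rewrite -(wmass_set1 UP); congr wmass; apply/seteqP; split => y.
  by move=> /agree_inj.
by move=> ->; apply/agreeP.
Qed.

Lemma gibbs_top (z : W N.+1) g : interlacing N g ->
  wmass (restrict_weight U [set x | level x ord_max = z]) (bottom_levels N g) =
  [forall i : 'I_N.+1, nth 0%N z i == g N i]%:R * pattern_weight lambda N g *
    (M z / hfun lambda z).
Proof.
move=> gP; rewrite wmass_restrict_level.
case: (boolP [forall i : 'I_N.+1, nth 0%N z i == g N i]) => [/forallP zg|_];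
  last by rewrite !mul0r.
have [x xg] := GT_of_array gP; have /agreeP xg' := xg.
have -> : bottom_levels N g = bottom_levels N (coords x) :> set (GT N.+1).
  by apply/seteqP; split=> v /agreeP vg; apply/agreeP => n j nN jn; rewrite vg// xg'.
rewrite wmass_pattern UE; have -> : level x ord_max = z.
  apply/level_eqP => j jN; rewrite xg'//.
  by have /eqP -> := zg (Ordinal (jN : (j < N.+1)%N)).
rewrite (@eq_pattern_weight _ lambda N (coords x) g); last first.
  by move=> n j nN jn; rewrite xg'// ltnW.
by rewrite !mul1r mulrCA mulrA.
Qed.

(* The quotient of the mass and the weight depends on the row [k] only; this passes
   from level [k.+1] to level [k] by summing over the row [k.+1]. *)
Lemma gibbs_bottom_levels k g g' : (k <= N)%N -> interlacing k g -> interlacing k g' ->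
  (forall j, (j <= k)%N -> g k j = g' k j) ->
  wmass U (bottom_levels k g) * pattern_weight lambda k g' =
  wmass U (bottom_levels k g') * pattern_weight lambda k g.
Proof.
move=> kN; have [d kd] : exists d, (k + d = N)%N by exists (N - k)%N; rewrite subnKC.
elim: d k kN kd g g' => [|d IH] k kN kd g g' gP gP' gg'.
  rewrite addn0 in kd; rewrite kd in gP gP' gg' *.
  have [x xg] := GT_of_array gP; have [x' xg'] := GT_of_array gP'.
  have bottomE (y : GT N.+1) h : agree N (coords y) h -> bottom_levels N h =
    bottom_levels N (coords y) :> set (GT N.+1).
    move=> /agreeP yh; apply/seteqP; split=> z /agreeP zh; apply/agreeP => n j nN jn.
      by rewrite zh// yh.
    by rewrite zh// yh.
  rewrite (bottomE _ _ xg) (bottomE _ _ xg') !wmass_pattern !UE.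
  have -> : level x ord_max = level x' ord_max.
    apply/(level_eqP x) => j jN; rewrite -coordsE.
    by move/agreeP : xg => -> //; move/agreeP : xg' => -> //; exact: gg'.
  have wE (y : GT N.+1) h : agree N (coords y) h -> pattern_weight lambda N (coords
    y) = pattern_weight lambda N h.
    by move=> /agreeP yh; apply: eq_pattern_weight => n j nN jn; rewrite yh// ltnW.
  by rewrite (wE _ _ xg) (wE _ _ xg'); ring.
have kN' : (k < N)%N by rewrite -kd addnS ltnS leq_addr.
have e z : wmass U (bottom_levels k g `&`
      (fun x => level x (Ordinal (kN' : (k.+1 < N.+1)%N))) @^-1` [set z]) *
        pattern_weight lambda k g' =
    wmass U (bottom_levels k g' `&`
      (fun x => level x (Ordinal (kN' : (k.+1 < N.+1)%N))) @^-1` [set z]) *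
        pattern_weight lambda k g.
  have B := @bottom_levelsS N k _ (nth 0%N z) kN' z (fun _ _ => erefl).
  have [zg|zg] := pselect (forall j,
    (j <= k)%N -> (nth 0%N z j <= g k j < nth 0%N z j.+1)%N).
    have zg' j : (j <= k)%N -> (nth 0%N z j <= g' k j < nth 0%N z j.+1)%N.
      by move=> jk; rewrite -gg'//; exact: zg.
    rewrite -!B; have := IH k.+1 kN' _ _ _ (interlacing_set_row gP zg)
      (interlacing_set_row gP' zg').
    rewrite !pattern_weight_set_row !pattern_weightS addSnnS => /(_ kd) H.
    have rE : row_weight lambda k.+1 (g k) = row_weight lambda k.+1 (g' k).
      by apply: eq_bigr => i _; rewrite gg'// -ltnS.
    rewrite -rE !mulrA in H; apply: (mulIf (lt0r_neq0 (row_weight_gt0 lambda_gt0 k.+1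
      (g k)))).
    by apply: H => j jk; rewrite /set_row eqxx.
  (* If z does not interlace with the common row k, both fibres are empty. *)
  have A0 h : (forall j, (j <= k)%N -> g k j = h k j) -> forall x,
      ~ (bottom_levels k h `&` (fun x =>
        level x (Ordinal (kN' : (k.+1 < N.+1)%N))) @^-1` [set z]) x.
    move=> gh x [/agreeP xh /level_eqP xz]; apply: zg => j jk.
    rewrite gh// -xh// -(xz j)//= -?(xz j.+1)//; last exact: leqW.
    exact: coords_interlacing.
  by rewrite !wmass_eq0 ?mul0r//; apply: A0.
apply: EFin_inj; rewrite !EFinM.
rewrite !(wmass_fiber (fun x => level x (Ordinal (kN' : (k.+1 < N.+1)%N))) _ UP).
rewrite ![((\esum_(_ in _) _) * _)%E]muleC -!esumZl ?ltW ?pattern_weight_gt0//.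
- by apply: eq_esum => z _; rewrite -!EFinM mulrC e mulrC.
- by move=> z; rewrite lee_fin; apply: wsum_ge0.
- by move=> z; rewrite lee_fin; apply: wsum_ge0.
Qed.

(** Take for r the ratio of mass to weight at one pattern with top row y; by [gibbs_bottom_levels]
    the choice does not matter. Its value is later recovered from the total mass through
    [hfun_mass]. *)
Lemma gibbs_level k (kN : (k < N.+1)%N) (y : W k.+1) :
  exists r, forall g, interlacing k g ->
  wmass (restrict_weight U [set x | level x (Ordinal kN) = y]) (bottom_levels k g) =
  [forall i : 'I_k.+1, nth 0%N y i == g k i]%:R * pattern_weight lambda k g * r.
Proof.
have [[g0 [gP0 yg0]]|ng] := pselect (exists g, interlacing k g /\
    [forall i : 'I_k.+1, nth 0%N y i == g k i]).
  exists (wmass U (bottom_levels k g0) / pattern_weight lambda k g0) => g gP.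
  rewrite wmass_restrict_level; case: (boolP [forall i : 'I_k.+1,
    nth 0%N y i == g k i]) => [yg|_]; last by rewrite !mul0r.
  rewrite !mul1r; have w0 := pattern_weight_gt0 lambda_gt0 k g0.
  apply: (mulIf (lt0r_neq0 w0)); rewrite -mulrA divfK ?gt_eqF// [RHS]mulrC.
  apply: gibbs_bottom_levels => // j jk.
  have jk' : (j < k.+1)%N by [].
  have /forallP/(_ (Ordinal jk'))/eqP /= <- := yg.
  by have /forallP/(_ (Ordinal jk'))/eqP /= := yg0.
exists 0 => g gP; rewrite wmass_restrict_level mulr0.
case: (boolP [forall i : 'I_k.+1, nth 0%N y i == g k i]) => [yg|_];
  last by rewrite mul0r.
by case: ng; exists g.
Qed.
End GibbsMeasures.

(** * Laws of Markov processes *)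

Section MarkovLaws.
Variables (R : realType) (d : measure_display) (Omega : measurableType d).
Variable P : probability Omega R.

(** Countable additivity is used over natural numbers, through [pickle]; the numbers that code no
    state give empty pieces. *)
Lemma probability_fiber (T : countType) (Y : Omega -> T) (E : set Omega) :
  measurable E -> (forall y, measurable [set w | Y w = y]) ->
  (P E = \esum_(y in [set: T]) P (E `&` [set w | Y w = y]))%E.
Proof.
move=> mE mY; pose F n := E `&` [set w | pickle (Y w) = n].
have FE y : F (pickle y) = E `&` [set w | Y w = y].
  apply/seteqP; split => w [Ew]; last by move=> /= <-.
  by move=> /(pcan_inj pickleK).
have F0 n : ~ range (@pickle T) n -> F n = set0.
  by move=> nr; apply/seteqP; split=> // w [_ /= Yn]; apply: nr; exists (Y w).
have mF n : measurable (F n).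
  have [[y _ <-]|nr] := pselect (range (@pickle T) n); last by rewrite F0.
  by rewrite FE; exact: measurableI.
have EF : E = \bigcup_(n in [set: nat]) F n.
  by apply/seteqP; split=> [w Ew|w [n _ []]//]; exists (pickle (Y w)).
rewrite [in LHS]EF measure_bigcup//; last by move=> i j _ _ [w [[_ /= <-] [_ /= <-]]].
rewrite nneseries_esum//.
rewrite (_ : [set x | x \in [set: nat]] = [set: nat]); last first.
  by apply/seteqP; split=> // n _ /=; rewrite in_setT.
rewrite (esumID (range (@pickle T))) => [|n _]; last exact: measure_ge0.
rewrite !setTI [X in (_ + X)%E]esum1 ?adde0 => [|n nr]; last by rewrite F0// measure0.
rewrite esum_image; last by move=> y y' _ _ /(pcan_inj pickleK).
by apply: eq_esum => y _; rewrite FE.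
Qed.

Lemma measurable_countable_fibers (T : countType) (Y : Omega -> T) (A : set T) :
  (forall y, measurable [set w | Y w = y]) -> measurable (Y @^-1` A).
Proof.
move=> mY; rewrite (_ : Y @^-1` A = \bigcup_(y : T) [set w | A y /\ Y w = y]);
  last first.
  apply/seteqP; split=> [w Aw|w [y _ [Ay Yw]]]; first by exists (Y w).
  by rewrite /preimage /= Yw.
apply: countable_bigcupT_measurable => // y.
have [Ay|nAy] := pselect (A y).
  by rewrite (_ : mkset _ = [set w | Y w = y])//; apply/seteqP; split=> [w []|].
by rewrite (_ : mkset _ = set0)//; apply/seteqP; split=> [w []|].
Qed.

Variables (S : countType) (X : R -> Omega -> S) (p : R -> S -> S -> R).
Hypothesis pP : transition_function p.
Hypothesis XP : markov_process P X p.
Variables (t : nat -> R) (m : nat) (A : nat -> set S).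
Hypothesis t0 : t 0%N = 0.
Hypothesis t_le : forall i, (i < m)%N -> t i <= t i.+1.

Let t_ge0 i : (i <= m)%N -> 0 <= t i.
Proof.
elim: i => [|i IH] im; first by rewrite t0.
by apply: le_trans (IH (ltnW im)) (t_le im).
Qed.

Let mX i x : (i <= m)%N -> measurable [set w | X (t i) w = x].
Proof. by move=> im; apply: XP.1; exact: t_ge0. Qed.

Definition past n : set Omega := [set w | forall i, (i < n)%N -> A i (X (t i) w)].

Lemma measurable_past n : (n <= m.+1)%N -> measurable (past n).
Proof.
elim: n => [|n IH] nm.
  by rewrite (_ : past 0 = setT)//; apply/seteqP; split.
rewrite (_ : past n.+1 = past n `&` X (t n) @^-1` A n).
  apply: measurableI; first by apply: IH; exact: ltnW.
  by apply: measurable_countable_fibers => y; exact: mX.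
apply/seteqP; split=> [w wA|w [wA wAn] i]; last first.
  by rewrite ltnS leq_eqVlt => /predU1P[->//|]; exact: wA.
by split; [move=> i ni; apply: wA; exact: ltnW|exact: wA].
Qed.

(** An unnormalised law at time [t n]: [past n] involves the earlier times only, and the constraint
    [A n] enters as a restriction before the next transport. *)
Definition past_law n x : R := fine (P (past n `&` [set w | X (t n) w = x])).

Let m_past_at n x : (n <= m)%N -> measurable (past n `&` [set w | X (t n) w = x]).
Proof.
by move=> nm; apply: measurableI; [apply: measurable_past; exact: leqW|exact: mX].
Qed.

Lemma past_lawE n x : (n <= m)%N ->
  ((past_law n x)%:E = P (past n `&` [set w | X (t n) w = x]))%E.
Proof. by move=> nm; rewrite fineK//; apply: fin_num_measure; exact: m_past_at. Qed.

Lemma past_law_weight n : (n <= m)%N -> summable_weight (past_law n).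
Proof.
move=> nm; split=> [x|]; first by apply: fine_ge0; exact: measure_ge0.
under eq_esum do rewrite past_lawE//.
have mp : measurable (past n) by apply: measurable_past; exact: leqW.
rewrite -(probability_fiber (Y := X (t n)))//; last by move=> y; exact: mX.
by rewrite (le_lt_trans (probability_le1 P mp))// ltry.
Qed.

Lemma wmass_past_law n B : (n <= m)%N ->
  ((wmass (past_law n) B)%:E = P (past n `&` X (t n) @^-1` B))%E.
Proof.
move=> nm; rewrite wmassE; last exact: past_law_weight.
have mp : measurable (past n) by apply: measurable_past; exact: leqW.
have mB : measurable (past n `&` X (t n) @^-1` B).
  by apply: measurableI => //; apply: measurable_countable_fibers => y; exact: mX.
rewrite [RHS](probability_fiber (Y := X (t n)))//; last by move=> y; exact: mX.
rewrite esum_mkcond; apply: eq_esum => y _; case: ifPn => [/set_mem By|/negP nBy].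
  rewrite past_lawE//; congr (P _); apply/seteqP; split=> w /=.
    by move=> [pw Xw]; split=> //; split=> //; rewrite /preimage /= Xw.
  by move=> [[pw _] Xw].
rewrite (_ : _ `&` _ = set0) ?measure0//; apply/seteqP; split=> // w [[_ /= Bw] Xw].
by apply: nBy; apply/mem_set; rewrite -Xw.
Qed.

(** [markov_process] speaks of single states at each time, so the event [past n] is split by the
    n-tuple of earlier states; on each piece the two product formulas differ by one factor. *)
Lemma past_step n x y : (n < m)%N ->
  (P (past n `&` [set w | X (t n) w = x] `&` [set w | X (t n.+1) w = y]) =
   P (past n `&` [set w | X (t n) w = x]) * (p (t n.+1 - t n) x y)%:E)%E.
Proof.
move=> nm; have nm' := ltnW nm.
pose Y w : n.-tuple S := [tuple X (t i) w | i < n].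
have YE w (s : n.-tuple S) : Y w = s <-> forall i, (i < n)%N -> X (t i) w = nth y s i.
  split=> [<- i ni|H].
    by rewrite -(tnth_nth y _ (Ordinal ni)) tnth_mktuple.
  by apply: eq_from_tnth => i; rewrite tnth_mktuple (tnth_nth y) H.
have mY s : measurable [set w | Y w = s].
  rewrite (_ : mkset _ = \bigcap_(i in [set i | (i < n)%N]) [set w | X (t i) w =
    nth y s i]); last first.
    by apply/seteqP; split=> w; rewrite /= YE => H i; apply: H.
  apply: bigcap_measurableType.
  by move=> i /= ni; apply: mX; rewrite ltnW// (ltn_trans ni).
have mE := m_past_at x nm'.
have mEy : measurable (past n `&` [set w | X (t n) w = x] `&` [set w | X (t n.+1) w =
  y]).
  by apply: measurableI => //; exact: mX.
have p0 : 0 <= p (t n.+1 - t n) x y.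
  by apply: (transition_ge0 pP); rewrite subr_ge0 t_le.
rewrite (probability_fiber mEy mY) (probability_fiber mE mY) muleC -esumZl//.
apply: eq_esum => s _.
have [sA|nsA] := pselect (forall i, (i < n)%N -> A i (nth y s i)); last first.
  have e0 (E : set Omega) : past n `&` E `&` [set w | Y w = s] = set0.
    apply/seteqP; split => // w [[pw _] /YE Yw]; apply: nsA => i ni.
    by rewrite -Yw//; exact: pw.
  by rewrite -[past n `&` _ `&` [set w | X (t n.+1) w = y]]setIA !e0 !measure0 mule0.
(* The path s, then x at index n; index n + 1 is out of range and returns the default value y, the
   last state wanted. *)
pose z i := nth y (rcons s x) i.
have zs i : (i < n)%N -> z i = nth y s i by move=> ni;
  rewrite /z nth_rcons size_tuple ni.
have zn : z n = x by rewrite /z nth_rcons size_tuple ltnn eqxx.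
have zn1 : z n.+1 = y by rewrite /z nth_default// size_rcons size_tuple.
have e1 : past n `&` [set w | X (t n) w = x] `&` [set w | Y w = s] =
    [set w | forall i, (i <= n)%N -> X (t i) w = z i].
  apply/seteqP; split=> [w [[_ Xn] /YE Yw] i|w H].
    by rewrite leq_eqVlt => /predU1P[->|ni]; rewrite ?zn// zs// Yw.
  split; last by apply/YE => i ni; rewrite H ?zs// ltnW.
  by split; [move=> i ni; rewrite H ?zs ?(ltnW ni)//; exact: sA|rewrite /= H// zn].
have e2 : past n `&` [set w | X (t n) w = x] `&` [set w | X (t n.+1) w =
  y] `&` [set w | Y w = s] =
    [set w | forall i, (i <= n.+1)%N -> X (t i) w = z i].
  rewrite setIAC e1; apply/seteqP; split=> [w [/= H Xy] i|w /= H].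
    by rewrite leq_eqVlt => /predU1P[->|]; [rewrite zn1|exact: H].
  by split=> [i ni|]; [apply: H; exact: leqW|rewrite /= H// zn1].
rewrite e2 e1 !XP.2//; last 2 first.
- by move=> i im; apply: t_le; exact: leq_trans im nm'.
- by move=> i im; apply: t_le; exact: leq_trans im nm.
by rewrite big_ord_recr /= EFinM muleA muleC zn zn1.
Qed.

Lemma past_lawS n : (n < m)%N ->
  past_law n.+1 = transport p (restrict_weight (past_law n) (A n)) (t n.+1 - t n).
Proof.
move=> nm; have nm' := ltnW nm; apply/funext => y.
have tn : 0 <= t n.+1 - t n by rewrite subr_ge0 t_le.
have w := restrict_summable (A n) (past_law_weight nm').
apply: EFin_inj; rewrite past_lawE// wsumE//; last exact: transition_bounded.
rewrite (probability_fiber (Y := X (t n)))//; last 2 first.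
- exact: m_past_at.
- by move=> x; exact: mX.
apply: eq_esum => x _; rewrite /restrict_weight -mulrA mulrCA EFinM EFinM past_lawE//.
rewrite -past_step//; case: (boolP (x \in A n)) => [/set_mem Ax|/negP nAx].
  rewrite mul1e; congr (P _); apply/seteqP; split=> v /=.
    by move=> [[pv Xy] Xx]; split => //; split=> // i ni; apply: pv; exact: ltnW.
  move=> [[pv Xx] Xy]; split=> //; split=> // i; rewrite ltnS leq_eqVlt.
  by move=> /predU1P[->|/pv//]; rewrite Xx.
rewrite mul0e (_ : _ `&` _ = set0) ?measure0//; apply/seteqP;
  split=> // v [[pv _] /= Xx].
by apply: nAx; apply/mem_set; rewrite -Xx; exact: pv.
Qed.

Lemma past_law0 x : (past_law 0 x)%:E = P [set w | X 0 w = x].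
Proof.
rewrite past_lawE// t0; congr (P _); apply/seteqP; split=> [w []//|w Xw].
by split.
Qed.
End MarkovLaws.

(** * Markov property of the levels and law at a fixed time *)

Section PushBlock.
Variables (R : realType) (lambda : nat -> R) (C : R) (etL : R -> nat -> nat -> R).
Variables (N : nat) (M : W N.+1 -> R) (p : R -> GT N.+1 -> GT N.+1 -> R).
Hypothesis lambda_gt0 : forall i : nat, 0 < lambda i.
Hypothesis lambda_le : forall i, lambda i <= C.
Hypothesis etLP : jump_transition_function (pure_birth_rate lambda) etL.
Hypothesis pP : jump_transition_function (@push_block_rate R lambda N.+1) p.
Variables (d : measure_display) (Omega : measurableType d) (P : probability Omega R).
Variable X : R -> Omega -> GT N.+1.
Hypothesis XP : markov_process P X p.
Hypothesis X0 : forall x : GT N.+1,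
     P [set w | X 0%R w = x] = gibbs lambda (fun z => (M z)%:E) x.

Let pT : transition_function p := jump_transition pP.

Lemma PkernelE k t (x y : W k.+1) : Pkernel lambda etL t x y =
  hfun lambda y / hfun lambda x * birth_det etL k t (nth 0%N x) (nth 0%N y).
Proof. by []. Qed.

Lemma past_law0_gibbs t A x : t 0%N = 0 -> past_law P X t A 0 x =
  M (level x ord_max) * (pattern_weight lambda N (coords x) / hfun lambda (level x
    ord_max)).
Proof.
move=> t0; apply: EFin_inj; rewrite (@past_law0 _ _ _ _ _ _ _ XP t 0 A t0)// X0.
by rewrite gibbsE// -EFinM.
Qed.

Lemma level_markov k (kN : (k < N.+1)%N) :
  markov_process P (fun t w => level (X t w) (Ordinal kN)) (Pkernel lambda etL
    (k:=k.+1)).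
Proof.
split=> [t y t0|n t y t0 tle].
  apply: (measurable_countable_fibers (Y := X t) [set x | level x (Ordinal kN) = y]).
  by move=> x; exact: XP.1.
pose A i : set (GT N.+1) := [set x | level x (Ordinal kN) = y i].
pose U i := past_law P X t A i.
have UP i : (i <= n)%N -> summable_weight (U i).
  by move=> ni; exact: (past_law_weight XP A t0 tle ni).
have mass i r : (i <= n)%N -> (forall g, interlacing k g ->
    wmass (restrict_weight (U i) (A i)) (bottom_levels k g) =
    [forall j : 'I_k.+1, nth 0%N (y i) j == g k j]%:R * pattern_weight lambda k g *
      r) ->
    wmass (U i) (A i) = hfun lambda (y i) * r.
  move=> ni gr; rewrite -(@hfun_mass _ lambda N k kN (restrict_weight (U i) (A i)) r
    (y i))//.
  - by rewrite wmass_restrict setIid.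
  - by apply: restrict_summable; exact: UP.
  move=> g gP gy; rewrite gr// (_ : [forall _, _]) ?mul1r//.
  by apply/forallP => j; rewrite gy// -ltnS.
(* Invariant: given the level-k rows so far, the unnormalised law of the bottom levels is r times
   the pattern weight. One step multiplies r by a determinant, and by [mass] the quantity h(y_i) r
   is the probability of the rows so far. *)
have law i : (i <= n)%N -> exists r,
    (forall g, interlacing k g -> wmass (restrict_weight (U i) (A i)) (bottom_levels
      k g) =
      [forall j : 'I_k.+1, nth 0%N (y i) j == g k j]%:R * pattern_weight lambda k g *
        r) /\
    hfun lambda (y i) * r = fine (P [set w | level (X 0 w) (Ordinal kN) = y 0%N]) *
      \prod_(j < i) Pkernel lambda etL (t j.+1 - t j) (y j) (y j.+1).
  elim: i => [|i IH] ni.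
    have [r rP] := gibbs_level lambda_gt0 (UP _ ni) (fun x =>
      past_law0_gibbs A x t0) kN (y 0%N).
    exists r; split=> //; rewrite big_ord0 mulr1 -(mass 0%N r)//.
    apply: EFin_inj; rewrite (wmass_past_law XP A t0 tle)// fineK; last first.
      apply: fin_num_measure.
      apply: (measurable_countable_fibers (Y := X 0) [set x | level x (Ordinal kN) =
        y 0%N]).
      by move=> x; exact: XP.1.
    by congr (P _); rewrite t0; apply/seteqP; split=> [w []//|w Xw]; split.
  have [r [rP hr]] := IH (ltnW ni).
  exists (birth_det etL k (t i.+1 - t i) (nth 0%N (y i)) (nth 0%N (y i.+1)) * r); split.
    move=> g gP; rewrite wmass_restrict_level -mulrA.
    case: (boolP [forall j : 'I_k.+1, nth 0%N (y i.+1) j == g k j]) =>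
      [/forallP yg|_]; last by rewrite !mul0r.
    rewrite !mul1r /U (past_lawS pT XP A t0 tle)//.
    rewrite (bottom_levels_evolution lambda_gt0 lambda_le etLP pP _ _ _ rP)//;
      last 3 first.
    - by move=> a b ab bk; apply: W_sorted.
    - by apply: restrict_summable; apply: UP; exact: ltnW.
    - by rewrite subr_ge0 tle.
    rewrite (@eq_birth_det _ _ k _ _ (g k) (nth 0%N (y i.+1))); last first.
      by move=> j jk; have /eqP := yg (Ordinal (jk : (j < k.+1)%N)).
    by rewrite mulrCA mulrA.
  rewrite big_ord_recr [RHS]mulrA -hr PkernelE.
  have := hfun_gt0 lambda_gt0 (y i).
  move: (hfun lambda (y i)) (hfun lambda (y i.+1)) (birth_det _ _ _ _ _) => h1 h2 D h10.
  by field; rewrite gt_eqF.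
have [r [rP hr]] := law n (leqnn n).
have E : [set w | forall i, (i <= n)%N -> level (X (t i) w) (Ordinal kN) = y i] =
    past X t A n `&` X (t n) @^-1` A n.
  apply/seteqP; split=> [w H|w [pw An] i].
    by split=> [i ni|]; apply: H => //; exact: ltnW.
  by rewrite leq_eqVlt => /predU1P[->//|]; exact: pw.
have m0 : measurable [set w | level (X 0 w) (Ordinal kN) = y 0%N].
  apply: (measurable_countable_fibers (Y := X 0) [set x | level x (Ordinal kN) =
    y 0%N]).
  by move=> x; exact: XP.1.
rewrite E -(wmass_past_law XP A t0 tle)// -[X in _ = (X * _)%E]fineK ?fin_num_measure//.
by rewrite -EFinM -hr -(mass _ _ (leqnn n) rP).
Qed.

(** The initial law is split by its top row z. Each piece is Gibbs with a deterministic top row and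
    constant M(z)/h(z), so [bottom_levels_evolution] applies with k = N. *)
Lemma push_block_law T x : 0 <= T -> P [set w | X T w = x] =
  gibbs lambda (evolve M (@Pkernel R lambda etL N.+1 T)) x.
Proof.
move=> T0; pose t i : R := if i is 0 then 0 else T.
pose A (i : nat) : set (GT N.+1) := setT.
have t0 : t 0%N = 0 by [].
have tle i : (i < 1)%N -> t i <= t i.+1 by case: i.
pose U := past_law P X t A 0.
have UP : summable_weight U := past_law_weight XP A t0 tle (leq0n _).
have UE v : U v = _ := past_law0_gibbs A v t0.
pose a (z : W N.+1) : R := birth_det etL N T (nth 0%N z) (nth 0%N (level x ord_max)) *
  pattern_weight lambda N (coords x) * (M z / hfun lambda z).
pose V (z : W N.+1) := restrict_weight U [set v | level v ord_max = z].
have VP z : summable_weight (V z) by exact: restrict_summable.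
have aE z : transport p (V z) T x = a z.
  have tV := transport_weight pT (VP z) T0.
  have -> : transport p (V z) T x =
    wmass (transport p (V z) T) (bottom_levels N (coords x)).
    rewrite -(wmass_set1 tV); congr wmass; apply/seteqP; split => v.
      by move=> ->; apply/agreeP.
    by move=> /agree_inj.
  rewrite (bottom_levels_evolution lambda_gt0 lambda_le etLP pP (leqnn N) (x := nth
    0%N z) (r := M z / hfun lambda z))//.
  - congr (_ * _ * _); apply: eq_birth_det => j jN; exact: (coordsE x ord_max).
  - by move=> i j ij jN; apply: W_sorted.
  - by move=> g gP; apply: (gibbs_top UP UE).
  - exact: coords_interlacing.
(* The sign is not visible on a determinant; it comes from [a z] being the mass of a state. *)
have a0 z : 0 <= a z.
  by rewrite -aE; case: (transport_weight pT (VP z) T0).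
transitivity (\esum_(z in [set: W N.+1]) (a z)%:E)%E.
  have -> : P [set w | X T w = x] = (past_law P X t A 1 x)%:E.
    rewrite (past_lawE XP A t0 tle)//; congr (P _).
    by apply/seteqP; split=> [w Xw|w []//]; split.
  rewrite (past_lawS pT XP A t0 tle)// subr0.
  have -> : restrict_weight (past_law P X t A 0) (A 0%N) = U.
    by apply/funext => v; rewrite /restrict_weight in_setT mulr1.
  rewrite wsumE//; last exact: transition_bounded.
  rewrite (esum_fiber (fun v => level v ord_max)); last first.
    by move=> v; rewrite lee_fin mulr_ge0 ?(transition_ge0 pT)//; case: UP.
  apply: eq_esum => z _; rewrite -aE wsumE//; last exact: transition_bounded.
  rewrite esum_mkcond; apply: eq_esum => v _; rewrite /V /restrict_weight.
  by rewrite /preimage /=; case: (_ \in _); rewrite ?mulr1 ?mulr0 ?mul0r.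
rewrite gibbsE// /evolve muleC.
have hx := hfun_gt0 lambda_gt0 (level x ord_max).
have wx := pattern_weight_gt0 lambda_gt0 N (coords x).
have E z : a z = pattern_weight lambda N (coords x) / hfun lambda (level x ord_max) *
    (M z * Pkernel lambda etL T z (level x ord_max)).
  have hz := hfun_gt0 lambda_gt0 z.
  rewrite PkernelE /a; move: (birth_det _ _ _ _ _) (pattern_weight _ _ _) hx hz.
  move: (hfun lambda (level x ord_max)) (hfun lambda z) => h1 h2 D w h10 h20.
  by field; rewrite !gt_eqF.
rewrite -esumZl ?divr_ge0 ?ltW//.
  by apply: eq_esum => z _; rewrite -EFinM E.
move=> z; rewrite lee_fin -(pmulr_rge0 _ (divr_gt0 wx hx)) -E//.
Qed.
End PushBlock.

Theorem proposition2p22 (R : realType)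
  (lambda : nat -> R)
  (lambda_gt0 : forall x, 0 < lambda x)
  (inf_lambda : (0 < ereal_inf (range (fun x => (lambda x)%:E)))%E)
  (sup_lambda : (ereal_sup (range (fun x => (lambda x)%:E)) < +oo)%E)
  (etL : R -> nat -> nat -> R)
  (etLP : jump_transition_function (pure_birth_rate lambda) etL)
  (N : nat)
  (M : W N.+1 -> R)
  (M_ge0 : forall z, 0 <= M z)
  (M_sum1 : (\esum_(z in [set: W N.+1]) (M z)%:E = 1)%E)
  (d : measure_display) (Omega : measurableType d) (P : probability Omega R)
  (X : R -> Omega -> GT N.+1)
  (X_dynamics : markov_jump_process P X (@push_block_rate R lambda N.+1))
  (X_initial : forall x : GT N.+1,
     P [set w | X 0%R w = x] = gibbs lambda (fun z => (M z)%:E) x) :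
  (forall k : 'I_N.+1,
     markov_process P (fun t w => level (X t w) k)
       (@Pkernel R lambda etL k.+1)) /\
  (forall (T : R) (x : GT N.+1), 0 <= T ->
     P [set w | X T w = x] =
     gibbs lambda (evolve M (@Pkernel R lambda etL N.+1 T)) x).
Proof.
have [_ [p pP XP]] := X_dynamics.
pose C := fine (ereal_sup (range (fun x => (lambda x)%:E))).
have lambda_le i : lambda i <= C.
  have le_sup : ((lambda i)%:E <= ereal_sup (range (fun x => (lambda x)%:E)))%E.
    by apply: ereal_sup_ubound; exists i.
  rewrite -lee_fin fineK// fin_numE; apply/andP; split; last by rewrite lt_eqF.
  by rewrite gt_eqF// (lt_le_trans _ le_sup)// ltNyr.
split=> [[k kN]|T x T0].
  exact: (level_markov lambda_gt0 lambda_le etLP pP XP X_initial kN).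
exact: (push_block_law lambda_gt0 lambda_le etLP pP XP X_initial x T0).
Qed.
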